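(* Let $p$ be a prime, $k>1$ a natural number, and let $F_{p^k}$ be the unitary Fourier matrix, $[F_{p^k}]_{i,j}=\frac1{\sqrt{p^k}}e^{\mathbf i\frac{2\pi}{p^k}(i-1)(j-1)}$. Let $\mathcal R_{F_{p^k}}$ be the set of all real $p^k\times p^k$ matrices $R$ satisfying the following (independent) linear constraints, where $\Delta^{i,j}_l=R_{i,l}-R_{j,l}$: - for every $m\in\{0,1,\dots,k-1\}$ (constraints of order $p^m$): $$\Delta^{i,i+p^m}_l=\Delta^{i,i+p^m}_{l+p^{k-(m+1)}}=\Delta^{i,i+p^m}_{l+2p^{k-(m+1)}}=\dots=\Delta^{i,i+p^m}_{l+(p-1)p^{k-(m+1)}}$$ for $l=1,2,\dots,p^{k-(m+1)}$ and for $i\in\bigcup_{r\in\{1,\dots,p^m\}}\{r+sp^m:\ s\in\{0,1,\dots,p^{k-m}-2\}\}$; - (dephasing constraints) $R_{1,1}=R_{2,1}=\dots=R_{p^k,1}=R_{1,2}=R_{1,3}=\dots=R_{1,p^k}=0$. Then $\mathcal R_{F_{p^k}}$ is a linear subspace of the real $p^k\times p^k$ matrices of dimension $\mathbf d(F_{p^k})=p^{k-1}\big((k-1)p-k\big)+1$, and if $R^{(1)},\dots,R^{(\mathbf d(F_{p^k}))}$ form a basis of $\mathcal R_{F_{p^k}}$, then $$\big\{\mathcal F(\phi_1,\dots,\phi_{\mathbf d(F_{p^k})}):\phi_i\in\mathbb R\big\},\qquad \mathcal F(\phi_1,\dots,\phi_{\mathbf d(F_{p^k})})=\mathrm{vec}_{\mathbb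 R}\Big(F_{p^k}\circ\mathrm{EXP}\Big(\mathbf i\sum_{i=1}^{\mathbf d(F_{p^k})}\phi_iR^{(i)}\Big)\Big),$$ is a $\mathbf d(F_{p^k})$-dimensional manifold containing (stemming from) $\mathrm{vec}_{\mathbb R}(F_{p^k})$, parametrized by $\mathcal F$, all of whose elements are of the form $\mathrm{vec}_{\mathbb R}(V)$ with $V$ a unitary complex Hadamard matrix dephased with respect to $F_{p^k}$.
   Context: For a complex $N\times N$ matrix $A$, $\mathrm{vec}_{\mathbb R}(A)\in\mathbb R^{2N^2}$ is the vector of real parts of the entries (row by row) followed by the vector of imaginary parts. $\circ$ is the entrywise (Hadamard) product; $\mathrm{EXP}(A)$ is the entrywise exponential. A unitary complex Hadamard matrix of size $N$ is a unitary $V$ with $|V_{i,j}|=1/\sqrt N$ for all $i,j$; here it is called dephased with respect to $F_{N}$ ($N=p^k$) if all entries of its first row and first column equal those of $F_N$, i.e. equal $1/\sqrt N$. Defect: let $f$ send a complex $N\times N$ matrix $U$ to $(|U_{i,j}|^2)_{i,j}$, with (real) differential $Df_U(V)=\big(2\,\mathrm{Re}(\overline{U_{i,j}}V_{i,j})\big)_{i,j}$; for unitary $U$ let $T_U=\{EU:E^*=-E\}$. Then $\mathbf d(U)=(N-1)^2-\dim_{\mathbb R}Df_U(T_U)$. *)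

(* Defs.v *)
From mathcomp Require Import all_boot all_order all_algebra.
From mathcomp Require Import complex.
From mathcomp Require Import all_classical all_reals all_analysis.

Set Implicit Arguments.
Unset Strict Implicit.
Unset Printing Implicit Defensive.

Import Order.TTheory GRing.Theory Num.Theory.
Import numFieldNormedType.Exports.

Local Open Scope classical_set_scope.
Local Open Scope ring_scope.
Local Open Scope complex_scope.
Local Open Scope sesquilinear_scope.

(* All row and column indices are 0-based. *)

Definition cexp (R : realType) (z : R[i]) : R[i] :=
  (expR (complex.Re z))%:C * (cos (complex.Im z) +i* sin (complex.Im z)).

Definition EXP (R : realType) (m n : nat) (A : 'M[R[i]]_(m, n)) :
  'M[R[i]]_(m, n) := map_mx (@cexp R) A.

Definition hadamard_product (R : realType) (m n : nat)
  (A B : 'M[R[i]]_(m, n)) : 'M[R[i]]_(m, n) := map2_mx *%R A B.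

(* [mxvec] lists the entries row by row. *)
Definition vecR (R : realType) (N : nat) (A : 'M[R[i]]_N) :
    'rV[R]_(N * N + N * N) :=
  row_mx (mxvec (map_mx (@complex.Re R) A)) (mxvec (map_mx (@complex.Im R) A)).

Definition fourier (R : realType) (N : nat) : 'M[R[i]]_N :=
  \matrix_(i < N, j < N)
    (((Num.sqrt (N%:R : R))^-1)%:C
       * cexp (0 +i* (2 * pi / N%:R * i%:R * j%:R))).

Definition unitary_complex_hadamard (R : realType) (N : nat)
    (V : 'M[R[i]]_N) : Prop :=
  V \is unitarymx /\
  forall i j : 'I_N, `|V i j| = ((Num.sqrt (N%:R : R))^-1)%:C.

Definition dephased_wrt (R : realType) (N : nat) (F V : 'M[R[i]]_N) : Prop :=
  forall i j : 'I_N, (val i = 0%N \/ val j = 0%N) -> V i j = F i j.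

(* The differential at [U] of [U |-> (|U i j| ^+ 2)_(i, j)]. *)
Definition Df (R : realType) (N : nat) (U V : 'M[R[i]]_N) : 'M[R]_N :=
  \matrix_(i < N, j < N) (2 * complex.Re ((U i j)^* * V i j)).

Definition tangent_unitary (R : realType) (N : nat) (U : 'M[R[i]]_N) :
    set 'M[R[i]]_N :=
  [set E *m U | E in [set E : 'M[R[i]]_N | E ^t* = - E]].

(* Junk value 0 when [S] is not a linear subspace. *)
Definition set_dim (K : fieldType) (V : vectType K) (S : set V) : nat :=
  xget 0%N [set d | exists W : {vspace V}, [set x | x \in W] = S /\ d = \dim W].

(* For unitary [U] the matrices in the image have zero row and column sums, so
   the dimension is at most [(N - 1) ^ 2] and the subtraction does not
   truncate. *)
Definition defect (R : realType) (N : nat) (U : 'M[R[i]]_N) : nat :=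
  ((N - 1) ^ 2 - set_dim (Df U @` tangent_unitary U))%N.

(* Access by natural numbers; only used with [i, j < N]. *)
Definition entry (R : realType) (N : nat) (i j : nat) (M : 'M[R]_N) : R :=
  match insub i : option 'I_N, insub j : option 'I_N with
  | Some i', Some j' => M i' j'
  | _, _ => 0
  end.

Definition Delta (R : realType) (N : nat) (i j l : nat) (M : 'M[R]_N) : R :=
  entry i l M - entry j l M.

Definition order_rows (p k m : nat) : seq nat :=
  [seq (r + s * p ^ m)%N | r <- iota 0 (p ^ m), s <- iota 0 (p ^ (k - m) - 1)].

(* The set of the matrices [M] satisfying the constraints of order [p ^ m] for
   all [m < k] and the dephasing constraints; a chain of [p] equal terms is
   given by its [p - 1] consecutive equalities. *)
Definition RF (R : realType) (p k : nat) : set 'M[R]_(p ^ k) :=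
  [set M |
    (forall m : nat, (m < k)%N ->
     forall i l t : nat, i \in order_rows p k m ->
       (l < p ^ (k - m.+1))%N -> (t.+1 < p)%N ->
       Delta i (i + p ^ m) (l + t * p ^ (k - m.+1)) M =
       Delta i (i + p ^ m) (l + t.+1 * p ^ (k - m.+1)) M)
    /\ (forall i : nat, (i < p ^ k)%N -> entry i 0 M = 0)
    /\ (forall j : nat, (0 < j < p ^ k)%N -> entry 0 j M = 0)].

Arguments RF : clear implicits.

Definition order_forms (R : realType) (p k m : nat) :
    seq ('M[R]_(p ^ k) -> R) :=
  [seq (fun M =>
          Delta x.1 (x.1 + p ^ m) (x.2 + t * p ^ (k - m.+1)) M
          - Delta x.1 (x.1 + p ^ m) (x.2 + t.+1 * p ^ (k - m.+1)) M)
     | x <- [seq (i, l) | i <- order_rows p k m, l <- iota 0 (p ^ (k - m.+1))],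
       t <- iota 0 (p - 1)].

Definition dephasing_forms (R : realType) (p k : nat) :
    seq ('M[R]_(p ^ k) -> R) :=
  [seq (fun M => entry i 0 M) | i <- iota 0 (p ^ k)]
  ++ [seq (fun M => entry 0 j M) | j <- iota 1 (p ^ k - 1)].

(* The left-hand sides of the constraints defining [RF], each written as
   [form = 0], as elements of the dual space. *)
Definition constraint_forms (R : realType) (p k : nat) :
    seq 'Hom('M[R]_(p ^ k), R^o) :=
  [seq linfun (f : 'M[R]_(p ^ k) -> R^o)
     | f <- flatten [seq order_forms R p k m | m <- iota 0 k]
            ++ dephasing_forms R p k].

Definition affine_family (R : realType) (N d : nat) (U : 'M[R[i]]_N)
    (B : d.-tuple 'M[R]_N) (phi : 'rV[R]_d) : 'rV[R]_(N * N + N * N) :=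
  vecR (hadamard_product U
    (EXP (map_mx (fun x : R => 0 +i* x)
                 (\sum_(i < d) phi 0 i *: tnth B i)))).

(* Continuous differentiability up to order [n] on an open set [U], by
   iterated directional derivatives. *)
Fixpoint class_C (R : realType) (a b n : nat) (U : set 'rV[R]_a)
    (f : 'rV[R]_a -> 'rV[R]_b) : Prop :=
  match n with
  | 0%N => forall x, U x -> {for x, continuous f}
  | n'.+1 => (forall x, U x -> differentiable f x) /\
             forall v : 'rV[R]_a, class_C n' U ('D_v f)
  end.

Definition smooth_on (R : realType) (a b : nat) (U : set 'rV[R]_a)
    (f : 'rV[R]_a -> 'rV[R]_b) : Prop := forall n : nat, class_C n U f.

(* [g] restricted to the open set [U] is a smooth immersion and a homeomorphism
   onto a relatively open subset of [M]; [h] is its continuous inverse. *)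
Definition local_parametrization (R : realType) (a b : nat)
    (M : set 'rV[R]_b) (U : set 'rV[R]_a) (g : 'rV[R]_a -> 'rV[R]_b) : Prop :=
  [/\ open U, smooth_on U g, (forall x, U x -> row_free ('J g x)) &
      exists (W : set 'rV[R]_b) (h : 'rV[R]_b -> 'rV[R]_a),
        [/\ open W, g @` U = M `&` W, {within M `&` W, continuous h} &
            forall x, U x -> h (g x) = x]].

(* Embedded smooth submanifold without boundary. *)
Definition submanifold (R : realType) (b : nat) (d : nat)
    (M : set 'rV[R]_b) : Prop :=
  forall y, M y -> exists (U : set 'rV[R]_d) (g : 'rV[R]_d -> 'rV[R]_b),
    local_parametrization M U g /\ (g @` U) y.

(* [f] need not be injective (tori); it has to restrict to a local
   parametrization near every point. *)
Definition parametrized_by (R : realType) (a b : nat)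
    (M : set 'rV[R]_b) (f : 'rV[R]_a -> 'rV[R]_b) : Prop :=
  range f = M /\
  forall x, exists U : set 'rV[R]_a, U x /\ local_parametrization M U f.

(* Main.v *)
(* Telescoping the constraints gives, for rows i, i' congruent modulo p ^ m,
   that R_(i, j) - R_(i', j) only depends on j modulo p ^ (k - m - 1). Hence
   every entry of R is a combination, with integer coefficients, of the pivot
   entries (i, j), i, j >= 1, such that i < p ^ m and j < p ^ (k - m) for some
   m. The constraints together with the pivots are p ^ (2 k) linear forms with
   no common zero, so they are independent, and the dimensions follow.
   Periodicity makes the sums of g (R_(i, j) - R_(i', j)) w ^ ((i - i') j) over
   j vanish: with g x = exp (i x) the family is unitary; with g x = x the matrix
   (i R o F) F^* is skew-Hermitian. By Fourier inversion the latter property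
   characterizes the (undephased) constraints, so that the matrices i R o F form
   the kernel of Df on the tangent space, which has real dimension N ^ 2.
   Finally, the arguments of the pivot entries are local coordinates on the
   family, and by the integrality of the coefficients the pivot entries
   determine all the entries, so the image is embedded. *)

Require Import Defs.
From HB Require Import structures.
From mathcomp Require Import all_boot all_order all_algebra.
From mathcomp Require Import complex.
From mathcomp Require Import all_classical all_reals all_analysis.
From mathcomp Require Import zify ring lra.

Set Implicit Arguments.
Unset Strict Implicit.
Unset Printing Implicit Defensive.

Import Order.TTheory GRing.Theory Num.Theory.
Import numFieldNormedType.Exports.

Local Open Scope classical_set_scope.
Local Open Scope ring_scope.

(** * The constraints and their pivots *)

Lemma entry_ord (R : realType) (N : nat) (M : 'M[R]_N) (i j : 'I_N) :
  entry i j M = M i j.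
Proof. by rewrite /entry !valK. Qed.

Lemma expn_subnK (p m k : nat) : (m <= k)%N -> (p ^ m * p ^ (k - m) = p ^ k)%N.
Proof. by move=> mk; rewrite -expnD subnKC. Qed.

(** Euclidean division by p^m: for i = r + s p^m with r < p^m, the bound s <= p^(k-m) - 2 says
    exactly that one more step of p^m stays below p^k. *)
Lemma mem_order_rows (p k m i : nat) : (0 < p)%N -> (m < k)%N ->
  (i \in order_rows p k m) = (i + p ^ m < p ^ k)%N.
Proof.
move=> p0 mk; have q0 : (0 < p ^ m)%N by rewrite expn_gt0 p0.
have := expn_subnK p (ltnW mk); set q := (p ^ m)%N; set Q := (p ^ (k - m))%N.
move=> <-; apply/allpairsP/idP => [[[r s] /= []]|h].
  rewrite !mem_iota !add0n /= => hr hs ->; rewrite -/q.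
  have : (s.+2 * q <= q * Q)%N by rewrite mulnC leq_pmul2l //; lia.
  by rewrite !mulSn; lia.
exists ((i %% q)%N, (i %/ q)%N); rewrite /= !mem_iota !add0n ltn_pmod //=.
split=> //; last by rewrite -/q [RHS]addnC -divn_eq.
have : ((i %/ q).+1 * q < Q * q)%N.
  apply: leq_ltn_trans (_ : i + q < _)%N; last by rewrite mulnC.
  by rewrite mulSn {2}(divn_eq i q); lia.
by rewrite ltn_pmul2r //; lia.
Qed.

Definition order_constrained (R : realType) (p k : nat) : set 'M[R]_(p ^ k) :=
  [set M | forall m : nat, (m < k)%N ->
     forall i l t : nat, i \in order_rows p k m ->
       (l < p ^ (k - m.+1))%N -> (t.+1 < p)%N ->
       Delta i (i + p ^ m) (l + t * p ^ (k - m.+1)) M =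
       Delta i (i + p ^ m) (l + t.+1 * p ^ (k - m.+1)) M].

Lemma Delta_trans (R : realType) (N : nat) (M : 'M[R]_N) i1 i2 i3 j :
  Delta i1 i3 j M = Delta i1 i2 j M + Delta i2 i3 j M.
Proof. by rewrite /Delta addrA subrK. Qed.

Lemma Delta_sym (R : realType) (N : nat) (M : 'M[R]_N) i1 i2 j :
  Delta i1 i2 j M = - Delta i2 i1 j M.
Proof. by rewrite /Delta opprB. Qed.

(** The period is refined from p^(k-m) to p^(k-m-1): the chain of order p^m links the p columns
    below p^(k-m) that share a residue modulo p^(k-m-1). Rows at distance a multiple of p^m follow
    by telescoping. *)
Lemma Delta_periodic_step (R : realType) (p k : nat) (M : 'M[R]_(p ^ k)) m :
  (0 < p)%N -> order_constrained M -> (m < k)%N ->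
  (forall i j, (i + p ^ m < p ^ k)%N -> (j < p ^ k)%N ->
    Delta i (i + p ^ m) j M = Delta i (i + p ^ m) (j %% p ^ (k - m)) M) ->
  forall i i' j, (i < p ^ k)%N -> (i' < p ^ k)%N -> (j < p ^ k)%N ->
    i = i' %[mod p ^ m] ->
    Delta i i' j M = Delta i i' (j %% p ^ (k - m.+1)) M.
Proof.
move=> p0 HM mk red.
have qE : (p ^ (k - m) = p * p ^ (k - m.+1))%N.
  by rewrite -expnS; congr (p ^ _)%N; lia.
set q := (p ^ (k - m.+1))%N in qE *; have q0 : (0 < q)%N by rewrite expn_gt0 p0.
have chain i l t : (i + p ^ m < p ^ k)%N -> (l < q)%N -> (t < p)%N ->
    Delta i (i + p ^ m) (l + t * q) M = Delta i (i + p ^ m) l M.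
  move=> hi hl; elim: t => [|t IHt] ht; first by rewrite mul0n addn0.
  rewrite -(IHt (ltnW ht)); apply/esym/HM => //.
  by rewrite mem_order_rows.
have one i j : (i + p ^ m < p ^ k)%N -> (j < p ^ k)%N ->
    Delta i (i + p ^ m) j M = Delta i (i + p ^ m) (j %% q) M.
  move=> hi hj; rewrite red // qE.
  have -> : (j %% q = j %% (p * q) %% q)%N by rewrite modn_dvdm // dvdn_mull.
  have : (j %% (p * q) < p * q)%N by rewrite ltn_pmod // muln_gt0 p0.
  move: (j %% (p * q))%N => j1 hj1.
  have h : (j1 %/ q < p)%N by rewrite ltn_divLR.
  by rewrite -(chain i _ _ hi (ltn_pmod j1 q0) h) [(j1 %% q + _)%N]addnC -divn_eq.
have many c i j : (i + c * p ^ m < p ^ k)%N -> (j < p ^ k)%N ->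
    Delta i (i + c * p ^ m) j M = Delta i (i + c * p ^ m) (j %% q) M.
  elim: c => [|c IHc] hi hj; first by rewrite mul0n addn0 /Delta !subrr.
  rewrite !(@Delta_trans _ _ M i (i + c * p ^ m)%N (i + c.+1 * p ^ m)%N).
  congr (_ + _).
    by apply: IHc => //; rewrite mulSn in hi; lia.
  have -> : (i + c.+1 * p ^ m = i + c * p ^ m + p ^ m)%N by rewrite mulSn; lia.
  by apply: one => //; rewrite mulSn in hi; lia.
have le i i' j : (i <= i')%N -> (i' < p ^ k)%N -> (j < p ^ k)%N ->
    i = i' %[mod p ^ m] -> Delta i i' j M = Delta i i' (j %% q) M.
  move=> ii' hi' hj e.
  have /dvdnP[c hc] : (p ^ m %| i' - i)%N by rewrite -eqn_mod_dvd // e.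
  have -> : i' = (i + c * p ^ m)%N by rewrite -hc subnKC.
  by apply: many => //; rewrite -hc subnKC.
move=> i i' j hi hi' hj e; have [ii'|/ltnW ii'] := leqP i i'; first exact: le.
by rewrite Delta_sym (le i' i) // -Delta_sym.
Qed.

(** Induction on the order: rows at distance p^(m+1) are congruent modulo p^m, so the conclusion for
    m supplies the period that the step for m + 1 refines. At order 0 the starting period p^k is
    trivial. *)
Lemma Delta_periodic (R : realType) (p k : nat) (M : 'M[R]_(p ^ k)) m i i' j :
  (0 < p)%N -> order_constrained M -> (m < k)%N ->
  (i < p ^ k)%N -> (i' < p ^ k)%N -> (j < p ^ k)%N -> i = i' %[mod p ^ m] ->
  Delta i i' j M = Delta i i' (j %% p ^ (k - m.+1)) M.
Proof.
move=> p0 HM; elim: m i i' j => [|m IH] i i' j mk.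
  apply: Delta_periodic_step => // {}i {}j _ hj.
  by rewrite subn0 (modn_small hj).
apply: Delta_periodic_step => // {}i {}j hi hj.
apply: IH => //; first exact: ltnW.
  by apply: leq_ltn_trans hi; rewrite leq_addr.
by rewrite expnS -[RHS]modnDmr modnMl addn0.
Qed.

Lemma trunc_log_bounds (p i : nat) : (1 < p)%N -> (0 < i)%N ->
  (p ^ trunc_log p i <= i < p ^ (trunc_log p i).+1)%N.
Proof. by move=> p1 i0; rewrite trunc_logP // trunc_log_ltn. Qed.

(* [G = {0}] yields the independence of the constraints, and [G = 2 pi Z] the
   embeddedness of the family. *)
Lemma order_constrained_determined (R : realType) (p k : nat) (G : R -> Prop)
    (M : 'M[R]_(p ^ k)) :
  (1 < p)%N -> (forall x y z, G x -> G y -> G z -> G (x + y - z)) ->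
  order_constrained M ->
  (forall i j m, (m <= k)%N -> (i < p ^ m)%N -> (j < p ^ (k - m))%N ->
    G (entry i j M)) ->
  forall i j, (i < p ^ k)%N -> (j < p ^ k)%N -> G (entry i j M).
Proof.
move=> p1 hG HM hS i j.
have p0 : (0 < p)%N by exact: ltnW.
have [n] := ubnP (i + j); elim: n i j => // n IH i j /ltnSE hn hi hj.
have [i0|i0] := posnP i.
  by apply: (hS i j 0%N) => //; rewrite ?i0 // subn0.
set m := trunc_log p i.
have /andP[m1 m2] : (p ^ m <= i < p ^ m.+1)%N by exact: trunc_log_bounds.
have mk : (m < k)%N by rewrite -(ltn_exp2l _ _ p1); apply: leq_ltn_trans hi.
have [hjq|hjq] := ltnP j (p ^ (k - m.+1)); first exact: (hS i j m.+1).
have hi' : (i %% p ^ m < p ^ m)%N by rewrite ltn_pmod // expn_gt0 p0.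
have hj' : (j %% p ^ (k - m.+1) < p ^ (k - m.+1))%N.
  by rewrite ltn_pmod // expn_gt0 p0.
have e : Delta i (i %% p ^ m) j M
       = Delta i (i %% p ^ m) (j %% p ^ (k - m.+1)) M.
  by apply: Delta_periodic => //; rewrite ?modn_mod //; lia.
move: e hi' hj'; set i' := (i %% p ^ m)%N; set j' := (j %% _)%N => e hi' hj'.
(* A rectangle with corner (i, j): as i' < p^m <= i and j' < p^(k-m-1) <= j, the other three corners
   have a smaller index sum. *)
have -> : entry i j M = entry i' j M + entry i j' M - entry i' j' M.
  by move: e; rewrite /Delta => e; rewrite -addrA -e addrC subrK.
by apply: hG; apply: IH; lia.
Qed.

(** The boxes i < p^m, j < p^(k-m) overlap; cutting the rows into the blocks p^m <= i < p^(m+1)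
    lists each pivot once, which makes counting possible. The block m = k - 1 would have no column j
    >= 1. *)
Definition pivots (p k : nat) : seq (nat * nat) :=
  flatten [seq [seq (i, j) | i <- iota (p ^ m) (p ^ m.+1 - p ^ m),
                             j <- iota 1 (p ^ (k - m.+1) - 1)]
          | m <- iota 0 (k - 1)].

Lemma mem_pivots (p k m i j : nat) : (1 < p)%N -> (0 < i)%N -> (0 < j)%N ->
  (m <= k)%N -> (i < p ^ m)%N -> (j < p ^ (k - m))%N -> (i, j) \in pivots p k.
Proof.
move=> p1 i0 j0 mk hi hj.
have mk' : (m < k)%N.
  rewrite ltn_neqAle mk andbT; apply/eqP => e.
  by move: hj; rewrite e subnn expn0; lia.
have /andP[h1 h2] := trunc_log_bounds p1 i0; set m' := trunc_log p i in h1 h2.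
have m'm : (m' < m)%N by rewrite -(ltn_exp2l _ _ p1); apply: leq_ltn_trans hi.
apply/flatten_mapP; exists m'; first by rewrite mem_iota; lia.
apply/allpairsP; exists (i, j); rewrite /= !mem_iota; split=> //.
  by rewrite h1 /=; lia.
have : (p ^ (k - m) <= p ^ (k - m'.+1))%N by rewrite leq_exp2l //; lia.
by lia.
Qed.

Lemma pivots_bound (p k i j : nat) : (1 < p)%N -> (i, j) \in pivots p k ->
  (i < p ^ k)%N /\ (j < p ^ k)%N.
Proof.
move=> p1 /flatten_mapP[m]; rewrite mem_iota => hm.
move=> /allpairsP[[i' j']] /= []; rewrite !mem_iota => h1 h2 [-> ->].
have : (p ^ m.+1 <= p ^ k)%N by rewrite leq_exp2l //; lia.
have : (p ^ (k - m.+1) <= p ^ k)%N by rewrite leq_exp2l //; lia.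
by split; lia.
Qed.

Lemma RF_determined (R : realType) (p k : nat) (G : R -> Prop)
    (M : 'M[R]_(p ^ k)) :
  (1 < p)%N -> G 0 -> (forall x y z, G x -> G y -> G z -> G (x + y - z)) ->
  RF R p k M -> (forall x, x \in pivots p k -> G (entry x.1 x.2 M)) ->
  forall i j : 'I_(p ^ k), G (M i j).
Proof.
move=> p1 G0 hG [HM [Hi Hj]] hS i j; rewrite -entry_ord.
apply: order_constrained_determined => // {}i {}j m mk hi hj.
have lk a b : (b <= k)%N -> (a < p ^ b)%N -> (a < p ^ k)%N.
  by move=> bk /leq_trans -> //; rewrite leq_exp2l.
have [j0|j0] := posnP j; first by rewrite j0 Hi //; apply: lk hi.
have [i0|i0] := posnP i.
  by rewrite i0 Hj // j0 /=; apply: lk hj; rewrite leq_subr.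
by apply: (hS (i, j)); apply: mem_pivots hi hj.
Qed.

(** * Independent systems of linear forms *)

Section LinearForms.
Variables (K : fieldType) (V : vectType K).
Implicit Types (X Y : seq 'Hom(V, K^o)) (v : V).

Lemma linfunE (W : vectType K) (f : V -> W) : linear f -> linfun f =1 f.
Proof.
move=> lf v.
pose lM := GRing.isLinear.Build _ _ _ _ _ lf.
pose g : {linear V -> W} := HB.pack f lM.
by rewrite -[f]/(g : V -> W) lfunE.
Qed.

Definition forms_eval X : 'Hom(V, 'rV[K]_(size X)) :=
  linfun (fun v => \row_(i < size X) (X`_i v : K)).

Lemma forms_evalE X v i : forms_eval X v 0 i = X`_i v.
Proof.
rewrite linfunE ?mxE // => a u w; apply/rowP => j.
by rewrite !mxE linearP.
Qed.

Lemma mem_lker_forms X v :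
  (v \in lker (forms_eval X)) = all (fun f : 'Hom(V, K^o) => f v == 0) X.
Proof.
rewrite memv_ker; apply/eqP/allP => [h f fX|h].
  rewrite -(nth_index 0 fX); have iX : (index f X < size X)%N by rewrite index_mem.
  by rewrite -[index f X]/(val (Ordinal iX)) -forms_evalE h mxE.
apply/rowP => i; rewrite forms_evalE mxE; apply/eqP/h.
by rewrite mem_nth.
Qed.

(** An injective linear map between spaces of equal dimension is onto. *)
Lemma forms_eval_surj X :
  (forall v, all (fun f : 'Hom(V, K^o) => f v == 0) X -> v = 0) ->
  size X = \dim {:V} -> forall y, exists v, forms_eval X v = y.
Proof.
move=> inj sX y.
have k0 : lker (forms_eval X) = 0%VS.
  apply/eqP; rewrite -subv0; apply/subvP => v.
  by rewrite mem_lker_forms memv0 => /inj ->.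
have : \dim (limg (forms_eval X)) = \dim {: 'rV[K]_(size X)}.
  have := limg_ker_dim (forms_eval X) fullv.
  by rewrite k0 capv0 dimv0 add0n => ->; rewrite -sX dimvf /dim /= mul1n.
move=> /eqP; rewrite dimvf -dimvf => /eqP e.
have fE : limg (forms_eval X) = fullv.
  by apply/eqP; rewrite eqEdim subvf e /=.
have : y \in limg (forms_eval X) by rewrite fE memvf.
by move=> /memv_imgP[v _ ->]; exists v.
Qed.

(** A vanishing combination, evaluated at a vector where form i is 1 and all the others are 0, loses
    all but its coefficient i. *)
Lemma forms_free X :
  (forall v, all (fun f : 'Hom(V, K^o) => f v == 0) X -> v = 0) ->
  size X = \dim {:V} -> free X.
Proof.
move=> inj sX; suff : free (in_tuple X) by []; apply/freeP => c hc i.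
have [v hv] := forms_eval_surj inj sX (delta_mx 0 i).
move/lfunP/(_ v): hc; rewrite sum_lfunE zero_lfunE.
under eq_bigr => j _.
  rewrite scale_lfunE -forms_evalE hv mxE eqxx /=.
  over.
rewrite (bigD1 i) //= eqxx big1 => [|j ji]; last first.
  by rewrite (negbTE ji) scaler0.
by rewrite addr0 => <-; rewrite /GRing.scale /= mulr1.
Qed.

(** Evaluation on [X] alone is still onto, so rank-nullity leaves [size Y] for its kernel. *)
Lemma dim_lker_forms X Y :
  (forall v, all (fun f : 'Hom(V, K^o) => f v == 0) (X ++ Y) -> v = 0) ->
  size (X ++ Y) = \dim {:V} -> \dim (lker (forms_eval X)) = size Y.
Proof.
move=> inj sX.
have fE : limg (forms_eval X) = fullv.
  apply/eqP; rewrite eqEsubv subvf /=; apply/subvP => y _.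
  (* The prescribed values [y] on [X] are completed by zeros on [Y]. *)
  have [v hv] := forms_eval_surj inj sX
    (\row_j (if insub (val j) is Some i then y 0 i else 0)).
  apply/memv_imgP; exists v; rewrite ?memvf //; apply/rowP => i.
  rewrite forms_evalE.
  have iXY : (i < size (X ++ Y))%N by rewrite size_cat ltn_addr.
  move/rowP/(_ (Ordinal iXY)): hv; rewrite forms_evalE mxE /= nth_cat ltn_ord.
  by rewrite valK => ->.
have := limg_ker_dim (forms_eval X) fullv.
rewrite capfv fE -sX size_cat [X in (_ + X)%N]dimvf /dim /= mul1n addnC.
by move/addnI.
Qed.

End LinearForms.

(** * Independence of the constraints *)

Lemma entry_linear (R : realType) (N i j : nat) :
  linear (fun M : 'M[R]_N => entry i j M : R^o).
Proof.
move=> a A B; rewrite /entry.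
case: insub => [i'|]; last by rewrite scaler0 addr0.
case: insub => [j'|]; last by rewrite scaler0 addr0.
by rewrite !mxE.
Qed.

Definition order_dual_forms (R : realType) (p k : nat) :
    seq 'Hom('M[R]_(p ^ k), R^o) :=
  [seq linfun (f : 'M[R]_(p ^ k) -> R^o)
     | f <- flatten [seq order_forms R p k m | m <- iota 0 k]].

Definition dephasing_dual_forms (R : realType) (p k : nat) :
    seq 'Hom('M[R]_(p ^ k), R^o) :=
  [seq linfun (f : 'M[R]_(p ^ k) -> R^o) | f <- dephasing_forms R p k].

Definition pivot_dual_forms (R : realType) (p k : nat) :
    seq 'Hom('M[R]_(p ^ k), R^o) :=
  [seq linfun (fun M : 'M[R]_(p ^ k) => entry x.1 x.2 M : R^o)
     | x <- pivots p k].

Lemma constraint_forms_cat (R : realType) (p k : nat) :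
  constraint_forms R p k = order_dual_forms R p k ++ dephasing_dual_forms R p k.
Proof. exact: map_cat. Qed.

Section Forms.
Variables (R : realType) (p k : nat).
Hypothesis p_gt1 : (1 < p)%N.
Implicit Type M : 'M[R]_(p ^ k).

Lemma order_dual_formsP M :
  reflect (order_constrained M)
    (all (fun f : 'Hom('M[R]_(p ^ k), R^o) => f M == 0) (order_dual_forms R p k)).
Proof.
have lin i l m t : linear ((fun M =>
    Delta i (i + p ^ m) (l + t * p ^ (k - m.+1)) M
    - Delta i (i + p ^ m) (l + t.+1 * p ^ (k - m.+1)) M)
    : 'M[R]_(p ^ k) -> R^o).
  by move=> a A B; rewrite /Delta !(entry_linear _ _ a A B); ring.
apply: (iffP allP) => [h m mk i l t hi hl ht|h _ /mapP[f /flatten_mapP[m + hf] ->]].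
  apply/eqP; rewrite -subr_eq0; move: (h (linfun ((fun M =>
    Delta i (i + p ^ m) (l + t * p ^ (k - m.+1)) M
    - Delta i (i + p ^ m) (l + t.+1 * p ^ (k - m.+1)) M)
    : 'M[R]_(p ^ k) -> R^o))).
  rewrite linfunE //; apply; apply/mapP; eexists; last by [].
  apply/flatten_mapP; exists m; first by rewrite mem_iota.
  apply/allpairsP; exists ((i, l), t); split => //=.
    apply/allpairsP; exists (i, l); split=> //=.
    by rewrite mem_iota.
  by rewrite mem_iota /= add0n; lia.
rewrite mem_iota /= add0n => mk.
move: hf => /allpairsP[[[i l] t] /= []].
move=> /allpairsP[[i' l'] /= [hi hl [-> ->]]] ht -> {f i l}.
rewrite linfunE // subr_eq0; apply/eqP; apply: h => //.
  by move: hl; rewrite mem_iota.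
by move: ht; rewrite mem_iota; lia.
Qed.

Lemma constraint_formsP M :
  reflect (RF R p k M)
    (all (fun f : 'Hom('M[R]_(p ^ k), R^o) => f M == 0) (constraint_forms R p k)).
Proof.
rewrite constraint_forms_cat all_cat.
have -> : all (fun f : 'Hom('M[R]_(p ^ k), R^o) => f M == 0)
    (dephasing_dual_forms R p k) =
  all (fun i => entry i 0 M == 0) (iota 0 (p ^ k)) &&
  all (fun j => entry 0 j M == 0) (iota 1 (p ^ k - 1)).
  rewrite /dephasing_dual_forms map_cat all_cat !all_map.
  by congr (_ && _); apply: eq_all => i /=; rewrite linfunE //;
    exact: entry_linear.
apply: (iffP and3P) => [[/order_dual_formsP h1 /allP h2 /allP h3]|].
  split=> //; split=> i hi; apply/eqP; first by apply: h2; rewrite mem_iota.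
  by apply: h3; rewrite mem_iota; lia.
move=> [/order_dual_formsP h1 [h2 h3]]; split=> //; apply/allP => i.
  by rewrite mem_iota add0n /= => hi; rewrite h2.
by rewrite mem_iota => hi; rewrite h3 //; lia.
Qed.

Lemma all_forms_inj M :
  all (fun f : 'Hom('M[R]_(p ^ k), R^o) => f M == 0)
    (constraint_forms R p k ++ pivot_dual_forms R p k) -> M = 0.
Proof.
rewrite all_cat => /andP[/constraint_formsP HM].
rewrite all_map => /allP hp.
apply/matrixP => i j; rewrite [RHS]mxE.
apply: (@RF_determined R p k (fun x => x = 0)) HM _ i j => //.
  by move=> x y z -> -> ->; rewrite subr0 addr0.
move=> x /hp /=; rewrite linfunE; last exact: entry_linear.
by move/eqP.
Qed.

(** Block m has (p^(m+1) - p^m) (p^(k-m-1) - 1) = (p^k - p^(k-1)) - (p^(m+1) - p^m) elements, and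
    the last differences telescope to p^n - 1. *)
Lemma size_pivots n : (n < k)%N ->
  (size (flatten [seq [seq (i, j) | i <- iota (p ^ m) (p ^ m.+1 - p ^ m),
                             j <- iota 1 (p ^ (k - m.+1) - 1)]
          | m <- iota 0 n]) + p ^ n = n * (p ^ k - p ^ k.-1) + 1)%N.
Proof.
elim: n => [|n IH] nk; first by rewrite mul0n expn0.
rewrite -[in iota _ _]addn1 iotaD map_cat flatten_cat size_cat /= cats0.
rewrite size_allpairs !size_iota add0n.
have := IH (ltnW nk); set s := size _.
have e1 : (p ^ n * p ^ (k - n.+1) = p ^ k.-1)%N.
  by rewrite -expnD; congr (p ^ _)%N; lia.
have e2 : (p ^ n.+1 * p ^ (k - n.+1) = p ^ k)%N.
  by rewrite -expnD; congr (p ^ _)%N; lia.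
have e3 : (p ^ n <= p ^ n.+1)%N by rewrite leq_exp2l.
have e4 : (0 < p ^ (k - n.+1))%N by rewrite expn_gt0 ltnW.
rewrite -e1 -e2 mulSn -mulnBl.
move: (p ^ n)%N (p ^ n.+1)%N (p ^ (k - n.+1))%N e3 e4 => a b c e3 e4.
have -> : ((b - a) * (c - 1) = (b - a) * c - (b - a))%N by rewrite mulnBr muln1.
have : (b - a <= (b - a) * c)%N by rewrite leq_pmulr.
by lia.
Qed.

(** Order p^m contributes (p^k - p^m) p^(k-m-1) (p - 1) forms, that is p^k (p^(k-m) - p^(k-m-1)) -
    (p^k - p^(k-1)); the first term telescopes over m. *)
Lemma size_order_forms n : (n <= k)%N ->
  (size (flatten [seq order_forms R p k m | m <- iota 0 n])
    + n * (p ^ k - p ^ k.-1) + p ^ k * p ^ (k - n) = p ^ k * p ^ k)%N.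
Proof.
elim: n => [|n IH] nk; first by rewrite mul0n subn0.
rewrite -[in iota _ _]addn1 iotaD map_cat flatten_cat size_cat /= cats0.
rewrite 2!size_allpairs !size_allpairs !size_iota add0n.
have := IH (ltnW nk); set s := size _.
have e1 : (p ^ n * p ^ (k - n.+1) = p ^ k.-1)%N.
  by rewrite -expnD; congr (p ^ _)%N; lia.
have e2 : (p ^ n * p ^ (k - n) = p ^ k)%N.
  by rewrite -expnD; congr (p ^ _)%N; lia.
have e3 : (p ^ (k - n) = p * p ^ (k - n.+1))%N.
  by rewrite -expnS; congr (p ^ _)%N; lia.
have e4 : (0 < p ^ (k - n.+1))%N by rewrite expn_gt0 ltnW.
rewrite -!e2 -e1 e3 mulSn.
move: (p ^ n)%N (p ^ (k - n.+1))%N e4 => a c c0.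
have e5 : (a * (p * c - 1) * c * (p - 1) + (a * (p * c) - a * c)
    + a * (p * c) * c = a * (p * c) * (p * c))%N.
  have [u ->] : exists u, p = u.+1 by exists p.-1; lia.
  have [v hv] : exists v, (u.+1 * c = v.+1)%N by exists (u.+1 * c).-1; nia.
  have -> : (a * (u.+1 * c) - a * c = a * (u * c))%N.
    by rewrite mulSn mulnDr addKn.
  have -> : (u.+1 * c - 1 = v)%N by rewrite hv; lia.
  have -> : (u.+1 - 1 = u)%N by lia.
  by rewrite hv; nia.
by move=> IH'; rewrite -[RHS]IH' -e5; lia.
Qed.

Lemma size_all_forms : (0 < k)%N ->
  size (constraint_forms R p k ++ pivot_dual_forms R p k)
    = \dim {: 'M[R]_(p ^ k)}.
Proof.
move=> k0; rewrite dimvf /dim /= size_cat constraint_forms_cat size_cat !size_map.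
have := size_order_forms (leqnn k).
have hk : (k.-1 < k)%N by lia.
have := size_pivots hk.
rewrite /pivots subn1 subnn expn0 muln1.
rewrite /dephasing_forms size_cat !size_map !size_iota.
have e0 : (0 < p ^ k.-1)%N by rewrite expn_gt0 ltnW.
have e1 : (p ^ k.-1 <= p ^ k)%N by rewrite leq_exp2l //; lia.
have -> x : (k * x = x + k.-1 * x)%N by rewrite -mulSn prednK.
move: (k.-1 * (p ^ k - p ^ k.-1))%N => D.
move: (p ^ k * p ^ k)%N (size _) (size _) => NN a b.
by move: (p ^ k)%N (p ^ k.-1)%N e0 e1 => P q e0 e1; lia.
Qed.

Lemma constraint_forms_free : (0 < k)%N -> free (constraint_forms R p k).
Proof.
move=> k0; apply: (catl_free (Y := pivot_dual_forms R p k)).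
by apply: forms_free; [exact: all_forms_inj | exact: size_all_forms].
Qed.

Definition RF_space : {vspace 'M[R]_(p ^ k)} :=
  lker (forms_eval (constraint_forms R p k)).

Definition order_space : {vspace 'M[R]_(p ^ k)} :=
  lker (forms_eval (order_dual_forms R p k)).

Lemma mem_RF_space M : M \in RF_space <-> RF R p k M.
Proof. by rewrite mem_lker_forms; split => /constraint_formsP. Qed.

Lemma mem_order_space M : M \in order_space <-> order_constrained M.
Proof. by rewrite mem_lker_forms; split => /order_dual_formsP. Qed.

Lemma size_pivotsE : (1 < k)%N ->
  size (pivots p k) = (p ^ (k - 1) * ((k - 1) * p - k) + 1)%N.
Proof.
move=> k1; have hk : (k.-1 < k)%N by lia.
have := size_pivots hk; rewrite /pivots subn1.
have -> : (p ^ k = p * p ^ k.-1)%N by rewrite -expnS prednK //; lia.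
have e0 : (0 < p ^ k.-1)%N by rewrite expn_gt0 ltnW.
move: (p ^ k.-1)%N e0 (size _) => q q0 n e.
have [u hu] : exists u, p = u.+2 by exists p.-2; lia.
have [w hw] : exists w, k = w.+2 by exists k.-2; lia.
move: e; rewrite hu hw /=.
have -> : (u.+2 * q - q = u.+1 * q)%N by rewrite mulSn addKn.
have -> : (w.+1 * u.+2 - w.+2 = w.+1 * u + w)%N by nia.
by nia.
Qed.

Lemma dim_RF_space : (1 < k)%N ->
  \dim RF_space = (p ^ (k - 1) * ((k - 1) * p - k) + 1)%N.
Proof.
move=> k1; rewrite -size_pivotsE // -(size_map
  (fun x => linfun (fun M => entry x.1 x.2 M : R^o) : 'Hom(_, _)) (pivots p k)).
by apply: dim_lker_forms; [exact: all_forms_inj | apply: size_all_forms; lia].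
Qed.

Lemma dim_order_space : (0 < k)%N ->
  (\dim order_space + size (order_dual_forms R p k) = p ^ k * p ^ k)%N.
Proof.
move=> k0; rewrite (@dim_lker_forms _ _ _
  (dephasing_dual_forms R p k ++ pivot_dual_forms R p k)).
- have := size_all_forms k0; rewrite dimvf /dim /= => <-.
  by rewrite constraint_forms_cat -catA !size_cat addnC.
- by move=> M; rewrite catA -constraint_forms_cat; exact: all_forms_inj.
- by rewrite catA -constraint_forms_cat; exact: size_all_forms.
Qed.

(** With N = p^k and d the number of pivots, dropping the 2 N - 1 dephasing forms gives dimension d
    + 2 N - 1, and N^2 - (d + 2 N - 1) = (N - 1)^2 - d. *)
Lemma dim_order_space_defect : (1 < k)%N ->
  ((p ^ k - 1) ^ 2 - (p ^ k * p ^ k - \dim order_space) =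
   p ^ (k - 1) * ((k - 1) * p - k) + 1)%N.
Proof.
move=> k1; have k0 : (0 < k)%N by lia.
have h1 := dim_order_space k0.
have h2 := size_all_forms k0; move: h2.
rewrite constraint_forms_cat -catA !size_cat dimvf /dim /=.
rewrite [size (pivot_dual_forms _ _ _)]size_map size_pivotsE //.
have -> : size (dephasing_dual_forms R p k) = (p ^ k + (p ^ k - 1))%N.
  by rewrite size_map /dephasing_forms size_cat !size_map !size_iota.
have N0 : (0 < p ^ k)%N by rewrite expn_gt0 ltnW.
move: (size _) (\dim _) h1 (_ + 1)%N => s D h1 d h2.
have [v hv] : exists v, (p ^ k = v.+1)%N by exists (p ^ k).-1; lia.
move: h1 h2; rewrite hv => h1 h2.
by rewrite subn1 /= -mulnn; nia.
Qed.

End Forms.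

(** * Trigonometric maps *)

(** Amplitudes [c] and phases [t] are kept free so that the class is closed under directional
    derivatives: one differentiation changes [c] and adds pi / 2 to [t]. Smoothness is then an
    induction on the order, and sines are covered by a phase shift. *)
Definition cos_map (R : realType) (d n : nat) (c t : 'rV[R]_n)
  (A : 'M[R]_(d, n)) (x : 'rV[R]_d) : 'rV[R]_n :=
  \row_j (c 0 j * cos ((x *m A) 0 j + t 0 j)).

Lemma is_diff_coord (R : realType) (d n : nat) (A : 'M[R]_(d, n)) j
    (x : 'rV[R]_d) :
  is_diff x (fun x => (x *m A) 0 j : R) (fun v => (v *m A) 0 j).
Proof.
have lf : linear (fun x : 'rV[R]_d => (x *m A) 0 j : R^o).
  by move=> a u v; rewrite mulmxDl -scalemxAl mxE [in LHS]mxE.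
pose lM := GRing.isLinear.Build _ _ _ _ _ lf.
pose f : {linear 'rV[R]_d -> R^o} :=
  HB.pack (fun x : 'rV[R]_d => (x *m A) 0 j : R^o) lM.
have fE : f = \sum_i (A i j *: (fun x : 'rV[R]_d => x 0 i : R^o)) :> (_ -> _).
  apply: funext => z; rewrite fct_sumE /= mxE.
  by apply: eq_bigr => i _; rewrite mulrC.
have cf : continuous f.
  move=> y; apply: differentiable_continuous; rewrite fE.
  by apply: differentiable_sum => i; apply/differentiableZ/differentiable_coord.
rewrite (_ : (fun x : 'rV[R]_d => (x *m A) 0 j : R) = f) //.
apply: DiffDef; first exact: linear_differentiable.
by rewrite diff_lin.
Qed.

Lemma is_diff_cos (R : realType) (y : R) :
  is_diff y (@cos R) (fun h => h * - sin y).
Proof.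
have dc : differentiable (@cos R) y by exact/derivable1_diffP/derivable_cos.
apply: DiffDef => //; rewrite diff1E // derive1E.
by have [_ ->] := is_derive_cos y.
Qed.

Lemma is_diff_coord_cos (R : realType) (d n : nat) (A : 'M[R]_(d, n)) j
    (c t : R) (x : 'rV[R]_d) :
  is_diff x (fun x => c * cos ((x *m A) 0 j + t))
    (fun v => c * (v *m A) 0 j * cos ((x *m A) 0 j + (t + pi / 2))).
Proof.
have d1 := is_diffD (is_diff_coord A j x) (is_diff_cst (t : R^o) x).
have d2 := @is_diff_comp _ _ _ _ _ _ _ _ x d1 (is_diff_cos _).
have := is_diffZ c d2.
set g := (X in is_diff _ _ X) => h.
suff <- : g = fun v : 'rV[R]_d =>
  c * (v *m A) 0 j * cos ((x *m A) 0 j + (t + pi / 2)) by exact: h.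
apply: funext => v.
rewrite addrA cosDpihalf /g /= !fctE /= !addr0; exact: mulrA.
Qed.

Lemma differentiable_cos_map (R : realType) (d n : nat) (c t : 'rV[R]_n)
    (A : 'M[R]_(d, n)) x : differentiable (cos_map c t A) x.
Proof.
rewrite (_ : cos_map c t A = \sum_j
    (fun x => (c 0 j * cos ((x *m A) 0 j + t 0 j)) *: delta_mx 0 j)); last first.
  apply: funext => y; rewrite fct_sumE [LHS]row_sum_delta.
  by apply: eq_bigr => j _; rewrite mxE.
apply: differentiable_sum => j.
apply: differentiableZl.
by have [] := is_diff_coord_cos A j (c 0 j) (t 0 j) x.
Qed.

Lemma derive_cos_map (R : realType) (d n : nat) (c t : 'rV[R]_n)
    (A : 'M[R]_(d, n)) (v x : 'rV[R]_d) :
  'D_v (cos_map c t A) x =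
  cos_map (\row_j (c 0 j * (v *m A) 0 j)) (\row_j (t 0 j + pi / 2)) A x.
Proof.
rewrite derive_mx; last first.
  exact/diff_derivable/differentiable_cos_map.
apply/rowP => j; rewrite !mxE.
rewrite (_ : (fun _ => _) = fun x => c 0 j * cos ((x *m A) 0 j + t 0 j)); last first.
  by apply: funext => y; rewrite mxE.
have [df dv] := is_diff_coord_cos A j (c 0 j) (t 0 j) x.
by rewrite deriveE // dv !mxE.
Qed.

Lemma smooth_cos_map (R : realType) (d n : nat) (U : set 'rV[R]_d)
  (c t : 'rV[R]_n) (A : 'M[R]_(d, n)) : smooth_on U (cos_map c t A).
Proof.
move=> k; elim: k c t => [|k IH] c t /=.
  by move=> x _; apply/differentiable_continuous/differentiable_cos_map.
split=> [x _|v]; first exact: differentiable_cos_map.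
by rewrite (funext (derive_cos_map c t A v)).
Qed.

Lemma cosD2pi_int (R : realType) (x : R) (z : int) :
  cos (x + z%:~R * (pi *+ 2)) = cos x.
Proof.
case: z => n.
  by rewrite -pmulrn mulr_natl; exact: (periodicn (@cosD2pi R)).
rewrite NegzE mulrNz mulNr -pmulrn mulr_natl.
by rewrite -[in RHS](subrK (pi *+ 2 *+ n.+1) x) [RHS](periodicn (@cosD2pi R)).
Qed.

Lemma sinD2pi_int (R : realType) (x : R) (z : int) :
  sin (x + z%:~R * (pi *+ 2)) = sin x.
Proof. by rewrite -!cosBpihalf addrAC cosD2pi_int. Qed.

Lemma cos_gt0_near_period (R : realType) (x : R) : 0 < cos x ->
  exists z : int, `|x - z%:~R * (pi *+ 2)| < pi / 2.
Proof.
move=> cx; have p0 : 0 < (pi : R) *+ 2 by rewrite mulrn_wgt0 ?pi_gt0.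
(* This choice puts the remainder [y] in [- pi, pi); as cos decreases on [0, pi] and vanishes at pi
   / 2, positivity of cos [y] then bounds [y]. *)
pose z := Num.floor ((x + pi) / (pi *+ 2)); exists z.
set y := x - _.
have cy : cos y = cos x by rewrite /y -mulNr -mulrNz cosD2pi_int.
have /andP[ylo yhi] : - pi <= y < pi.
  have /andP[h1 h2] := Num.Theory.floor_itv ((x + pi) / (pi *+ 2)).
  have {}h1 : z%:~R * (pi *+ 2) <= x + pi by rewrite -ler_pdivlMr.
  have {}h2 : x + pi < (z + 1)%:~R * (pi *+ 2) by rewrite -ltr_pdivrMr.
  move: h2; rewrite intrD mulrDl mul1r => h2.
  apply/andP; split; first by rewrite /y; lra.
  by rewrite /y; lra.
have ny : `|y| <= pi by rewrite ler_norml ylo ltW.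
have hp := pihalf_02 R.
rewrite ltNge; apply/negP => h.
have : (cos (pi / 2) < cos `|y|) = (`|y| < pi / 2).
  apply: ltr_cos; rewrite in_itv /= ?ny ?normr_ge0 //.
  by have p1 := pi_gt0 R; apply/andP; split; lra.
by rewrite cos_pihalf cos_norm cy cx ltNge h.
Qed.

Lemma continuous_coord_comb (R : realType) (m : nat) (a b : R) (j k : 'I_m) :
  continuous (fun y : 'rV[R]_m => a * y 0 j + b * y 0 k).
Proof.
move=> y.
have [dg _] := is_diff_coord (a *: delta_mx j 0 + b *: delta_mx k 0 : 'cV_m) 0 y.
have := differentiable_continuous dg; congr (continuous_at _ _).
apply: funext => w.
by rewrite mulmxDr -!scalemxAr -!colE !mxE.
Qed.

Lemma open_forall (T : topologicalType) (I : finType) (P : I -> set T) :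
  (forall i, open (P i)) -> open [set x | forall i, P i x].
Proof.
move=> oP; rewrite openE => x xP.
have : \forall y \near x, forall i, P i y.
  apply: filter_forall => i.
  by have := oP i; rewrite openE; apply; exact: xP.
exact.
Qed.

(** * Local parametrizations of linear torus maps *)

Section Torus.
Variables (R : realType) (d n s : nat) (r : R) (A : 'M[R]_(d, n)).
Variables (t : 'rV[R]_n) (f : 'I_s -> 'I_n).
Let Af := colsub f A.
Hypotheses (r_gt0 : 0 < r) (Afree : row_free Af) (Afull : row_full Af).
Hypothesis period : forall x : 'rV[R]_d,
  (forall i, exists z : int, (x *m A) 0 (f i) = z%:~R * (pi *+ 2)) ->
  forall j, exists z : int, (x *m A) 0 j = z%:~R * (pi *+ 2).

(** The real parts, then the imaginary parts, of r exp (i (x A + t)), each sine being a cosine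
    delayed by pi / 2. *)
Definition torus_map : 'rV[R]_d -> 'rV[R]_(n + n) :=
  cos_map (const_mx r) (row_mx t (t - const_mx (pi / 2))) (row_mx A A).

Lemma torus_mapl x j :
  torus_map x 0 (lshift n j) = r * cos ((x *m A) 0 j + t 0 j).
Proof. by rewrite mxE mul_mx_row !row_mxEl !mxE. Qed.

Lemma torus_mapr x j :
  torus_map x 0 (rshift n j) = r * sin ((x *m A) 0 j + t 0 j).
Proof. by rewrite mxE mul_mx_row !row_mxEr !mxE addrA cosBpihalf. Qed.

Lemma torus_map_period x y :
  (forall j, exists z : int, ((x - y) *m A) 0 j = z%:~R * (pi *+ 2)) ->
  torus_map x = torus_map y.
Proof.
move=> h; have e j : exists z : int,
    (x *m A) 0 j + t 0 j = (y *m A) 0 j + t 0 j + z%:~R * (pi *+ 2).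
  have [z hz] := h j; exists z; rewrite -hz mulmxBl !mxE; ring.
apply/rowP => i; case: (split_ordP i) => j ->.
  by rewrite !torus_mapl; have [z ->] := e j; rewrite cosD2pi_int.
by rewrite !torus_mapr; have [z ->] := e j; rewrite sinD2pi_int.
Qed.

Lemma colsub_mulE (x : 'rV[R]_d) i : (x *m Af) 0 i = (x *m A) 0 (f i).
Proof. by rewrite /Af mulmx_colsub mxE. Qed.

(** With u = v A, the derivative along v has the coordinates - r u_j sin b and r u_j cos b, which
    vanish together only if u_j = 0; the selected columns then force v = 0. *)
Lemma torus_immersion x : row_free ('J torus_map x).
Proof.
apply: inj_row_free => v; rewrite -deriveEjacobian; last first.
  exact: differentiable_cos_map.
rewrite /torus_map derive_cos_map => v0.
have vA0 j : (v *m A) 0 j = 0.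
  move: v0; rewrite /cos_map !mul_mx_row.
  move: (v *m A) (x *m A) => u w v0.
  set b := w 0 j + t 0 j.
  have hc : u 0 j * cos b = 0.
    move/rowP/(_ (rshift n j)): (v0).
    rewrite !(row_mxEr, mxE) subrK -/b => /eqP.
    by rewrite -mulrA mulf_eq0 gt_eqF //= => /eqP.
  have hs : u 0 j * sin b = 0.
    move/rowP/(_ (lshift n j)): (v0).
    rewrite !(row_mxEl, mxE) addrA -/b cosDpihalf.
    by move=> /eqP; rewrite -mulrA mulf_eq0 gt_eqF //= mulrN oppr_eq0 => /eqP.
  by rewrite -[LHS]mulr1 -(cos2Dsin2 b) !expr2 mulrDr !mulrA hc hs !mul0r addr0.
suff : v *m Af = 0 by move/eqP; rewrite mulmx_free_eq0 // => /eqP.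
apply/rowP => i.
by rewrite colsub_mulE vA0 mxE.
Qed.

Variable x0 : 'rV[R]_d.
Let b0 i := (x0 *m A) 0 (f i) + t 0 (f i).

Definition torus_chart_dom : set 'rV[R]_d :=
  [set x | forall i, `|((x - x0) *m A) 0 (f i)| < pi / 2].

(** In the plane of the cosine and sine of index [f i], these are the coordinates rotated back by
    the angle [b0 i] of the base point. On the image they are r times the cosine and sine of the
    angle measured from [x0]. *)
Let Wc i (y : 'rV[R]_(n + n)) : R :=
  cos (b0 i) * y 0 (lshift n (f i)) + sin (b0 i) * y 0 (rshift n (f i)).
Let Ws i (y : 'rV[R]_(n + n)) : R :=
  cos (b0 i) * y 0 (rshift n (f i)) - sin (b0 i) * y 0 (lshift n (f i)).

Definition torus_chart_nbhs : set 'rV[R]_(n + n) :=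
  [set y | forall i, 0 < Wc i y].

(** The arctangents recover the selected angle differences while these stay in (- pi / 2, pi / 2),
    and the inverse of the square matrix [Af] turns them back into parameters. *)
Definition torus_chart (y : 'rV[R]_(n + n)) : 'rV[R]_d :=
  x0 + \sum_i atan (Ws i y / Wc i y) *: row i (pinvmx Af).

Let WcE i x : Wc i (torus_map x) = r * cos (((x - x0) *m A) 0 (f i)).
Proof.
rewrite /Wc torus_mapl torus_mapr /b0 mulmxBl.
set a := (x *m A) 0 (f i); set c := (x0 *m A) 0 (f i); set e := t 0 (f i).
have -> : (x *m A - x0 *m A) 0 (f i) = (a + e) - (c + e).
  by rewrite !mxE -/(a) /a /c !mxE; ring.
rewrite cosB; ring.
Qed.

Let WsE i x : Ws i (torus_map x) = r * sin (((x - x0) *m A) 0 (f i)).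
Proof.
rewrite /Ws torus_mapl torus_mapr /b0 mulmxBl.
set a := (x *m A) 0 (f i); set c := (x0 *m A) 0 (f i); set e := t 0 (f i).
have -> : (x *m A - x0 *m A) 0 (f i) = (a + e) - (c + e).
  by rewrite !mxE -/(a) /a /c !mxE; ring.
rewrite sinB; ring.
Qed.

Let Wc_cont i : continuous (Wc i).
Proof. exact: continuous_coord_comb. Qed.

Let Ws_cont i : continuous (Ws i).
Proof.
rewrite (_ : Ws i = fun y => cos (b0 i) * y 0 (rshift n (f i)) +
  - sin (b0 i) * y 0 (lshift n (f i))); first exact: continuous_coord_comb.
by apply: funext => y; rewrite mulNr.
Qed.

Lemma open_torus_chart_dom : open torus_chart_dom.
Proof.
apply: open_forall => i.
apply: (@open_comp _ _ (fun x : 'rV[R]_d => `|((x - x0) *m A) 0 (f i)|)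
  [set y | y < pi / 2]); last exact: open_lt.
move=> x _; apply: (@continuous_comp _ _ _
  (fun x : 'rV[R]_d => ((x - x0) *m A) 0 (f i)) Num.norm); last first.
  exact: norm_continuous.
have [dg _] := is_diffD (is_diff_coord A (f i) x)
  (is_diff_cst (- (x0 *m A) 0 (f i) : R^o) x).
have := differentiable_continuous dg; congr (continuous_at _ _).
by apply: funext => w; rewrite mulmxBl [RHS]mxE [X in _ = _ + X]mxE.
Qed.

Lemma open_torus_chart_nbhs : open torus_chart_nbhs.
Proof.
apply: open_forall => i.
apply: (@open_comp _ _ (Wc i) [set y | 0 < y]); last exact: open_gt.
by move=> y _; exact: Wc_cont.
Qed.

Lemma torus_chart_continuous y : torus_chart_nbhs y ->
  {for y, continuous torus_chart}.
Proof.
move=> yW.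
have ha i : atan (Ws i z / Wc i z) @[z --> y] --> atan (Ws i y / Wc i y).
  apply: (@continuous_comp _ _ _ (fun z => Ws i z / Wc i z)); last first.
    exact: continuous_atan.
  apply: continuousM; first exact: Ws_cont.
  by apply: continuousV; [rewrite gt_eqF //; exact: yW | exact: Wc_cont].
have hr i : atan (Ws i z / Wc i z) *: row i (pinvmx Af) @[z --> y] -->
    atan (Ws i y / Wc i y) *: row i (pinvmx Af).
  by apply: (@cvgZr_tmp _ _ _ (nbhs y) _ _ _ (row i (pinvmx Af)) (ha i)).
have hs : \sum_i atan (Ws i z / Wc i z) *: row i (pinvmx Af) @[z --> y] -->
    \sum_i atan (Ws i y / Wc i y) *: row i (pinvmx Af).
  exact: (@cvg_big 'rV[R]_d 'I_s +%R 0 xpredT (@add_continuous _) _ (nbhs y) _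
    (fun i z => atan (Ws i z / Wc i z) *: row i (pinvmx Af)) _ _
    (fun i _ => hr i)).
exact: (cvgD (cvg_cst x0) hs).
Qed.

Lemma torus_chartK x : torus_chart_dom x -> torus_chart (torus_map x) = x.
Proof.
move=> xU; rewrite /torus_chart.
under eq_bigr => i _.
  rewrite WcE WsE -mulf_div divff ?gt_eqF // mul1r -/(tan _) tanK; last first.
    by rewrite in_itv /=; rewrite -ltr_norml; apply: xU.
  rewrite -colsub_mulE.
  over.
rewrite -mulmx_sum_row mulmxKp // addrC subrK //.
Qed.

(** Positive rotated cosines place each selected angle within pi / 2 of some 2 pi z_i. Solving for a
    parameter [w] with exactly these selected angles, [period] makes [w] a period of the whole map,
    and x - w lies in the domain: no distant sheet of the image enters the neighbourhood. *)
Lemma torus_chart_image :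
  torus_map @` torus_chart_dom = range torus_map `&` torus_chart_nbhs.
Proof.
apply/seteqP; split => [_ [x xU <-]|_ [[x _ <-] xW]].
  split; first by exists x.
  move=> i; rewrite WcE mulr_gt0 // cos_gt0_pihalf //.
  by rewrite -ltr_norml; apply: xU.
have /all_sig[z hz] i : {z : int |
    `|((x - x0) *m A) 0 (f i) - z%:~R * (pi *+ 2)| < pi / 2}.
  apply/cid/cos_gt0_near_period.
  by have := xW i; rewrite WcE pmulr_rgt0.
pose w := (\row_i ((z i)%:~R * (pi *+ 2))) *m pinvmx Af.
have wE i : (w *m A) 0 (f i) = (z i)%:~R * (pi *+ 2).
  by rewrite -colsub_mulE mulmxKpV ?submx_full // mxE.
exists (x - w).
  move=> i; rewrite addrAC mulmxBl mxE [X in _ + X]mxE wE.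
  exact: hz.
apply: torus_map_period; apply: period => i; exists (- z i).
by rewrite addrAC subrr add0r mulNmx mxE wE mulrNz mulNr.
Qed.

Lemma torus_local_parametrization :
  torus_chart_dom x0 /\
  local_parametrization (range torus_map) torus_chart_dom torus_map.
Proof.
split.
  by move=> i; rewrite subrr mul0mx mxE normr0 divr_gt0 ?pi_gt0.
split; first exact: open_torus_chart_dom.
- exact: smooth_cos_map.
- by move=> x _; exact: torus_immersion.
exists torus_chart_nbhs, torus_chart; split.
- exact: open_torus_chart_nbhs.
- exact: torus_chart_image.
- apply: continuous_in_subspaceT => y; rewrite inE => -[_ yW].
  exact: torus_chart_continuous.
- exact: torus_chartK.
Qed.

End Torus.

(** * Fourier sums *)

Local Open Scope complex_scope.
Local Open Scope sesquilinear_scope.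

Lemma conjcE (R : realType) (z : R[i]) : conjc z = Num.conj z.
Proof. by []. Qed.

Definition cis (R : realType) (x : R) : R[i] := cos x +i* sin x.

Section Cis.
Variable R : realType.
Implicit Types x y : R.

Lemma cexp_imag x : cexp (0 +i* x) = cis x.
Proof. by rewrite /cexp /= expR0 mul1r. Qed.

Lemma cisD x y : cis (x + y) = cis x * cis y.
Proof.
rewrite /cis cosD sinD; apply/eqP; rewrite eq_complex /=.
by apply/andP; split; apply/eqP; ring.
Qed.

Lemma cis0 : cis (0 : R) = 1.
Proof. by rewrite /cis cos0 sin0. Qed.

Lemma cisN x : cis (- x) = (cis x)^*%R.
Proof. by rewrite /cis cosN sinN. Qed.

Lemma cis_mul_conj x : cis x * (cis x)^*%R = 1.
Proof. by rewrite -cisN -cisD subrr cis0. Qed.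

Lemma norm_cis x : `|cis x| = 1.
Proof. by apply/eqP; rewrite -sqrp_eq1 // sqr_normc conjcE cis_mul_conj. Qed.

Lemma cisMn x n : cis (x * n%:R) = cis x ^+ n.
Proof.
elim: n => [|n IH]; first by rewrite mulr0 cis0 expr0.
by rewrite exprSr -IH -cisD -addn1 natrD mulrDr mulr1.
Qed.

(** cos x = 1 - 2 sin (x / 2)^2, and sin (x / 2) > 0 on this interval. *)
Lemma cis_neq1 x : 0 < x < pi *+ 2 -> cis x != 1.
Proof.
move=> /andP[x0 x2]; rewrite /cis eq_complex /= negb_and.
apply/orP; left; apply/eqP => c1.
have h : 0 < sin (x / 2).
  by apply: sin_gt0_pi; apply/andP; split; move: x2; rewrite mulr2n; lra.
have : cos x = 1 - (sin (x / 2) ^+ 2) *+ 2.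
  rewrite {1}(splitr x) cosD -!expr2 cos2sin2 mulr2n; ring.
rewrite c1 => /eqP; rewrite eq_sym subr_eq addrC -subr_eq subrr eq_sym.
by rewrite mulrn_eq0 /= expf_eq0 /= gt_eqF.
Qed.

End Cis.

Section Fourier.
Variables (R : realType) (N : nat).
Hypothesis N_gt0 : (0 < N)%N.

Definition dft_root : R[i] := cis (2 * pi / N%:R).
Local Notation w := dft_root.
Let r : R[i] := ((Num.sqrt (N%:R : R))^-1)%:C.

Lemma dft_rootX n : w ^+ n = cis (2 * pi / N%:R * n%:R).
Proof. by rewrite cisMn. Qed.

Lemma dft_root_prim : N.-primitive_root w.
Proof.
have N0 : (N%:R : R) != 0 by rewrite pnatr_eq0 -lt0n.
apply/andP; split=> //; apply/forallP => i; apply/eqP.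
rewrite unity_rootE dft_rootX; have [->|iN] := eqVneq i.+1 N.
  rewrite divfK // mulrC mulr_natr /cis cos2pi sin2pi.
  by rewrite eqxx.
apply/negbTE/cis_neq1.
have Np : 0 < (N%:R : R) by rewrite ltr0n.
have -> : 2 * pi / N%:R * i.+1%:R = pi *+ 2 * (i.+1%:R / N%:R) :> R.
  by rewrite mulr2n; field.
have p2 : 0 < (pi : R) *+ 2 by rewrite mulrn_wgt0 ?pi_gt0.
rewrite mulr_gt0 ?divr_gt0 ?ltr0n //= -[ltRHS]mulr1 ltr_pM2l //.
by rewrite ltr_pdivrMr // mul1r ltr_nat ltn_neqAle iN ltn_ord.
Qed.

Lemma dft_root_conj : w * w^*%R = 1.
Proof. exact: cis_mul_conj. Qed.

Lemma dft_root_neq0 : w != 0.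
Proof.
apply/eqP => w0; have := dft_root_conj; rewrite w0 mul0r => /eqP.
by rewrite eq_sym oner_eq0.
Qed.

Lemma dft_root_conjV : w^*%R = w^-1.
Proof. by rewrite -[RHS]mul1r -dft_root_conj mulrAC divff ?mul1r // dft_root_neq0. Qed.

Lemma fourierE (i j : 'I_N) : fourier R N i j = r * w ^+ (i * j).
Proof. by rewrite mxE cexp_imag dft_rootX natrM mulrA. Qed.

Lemma r_sqr : r * r = N%:R^-1.
Proof.
rewrite /r -rmorphM -invfM -expr2 sqr_sqrtr ?ler0n // rmorphV ?rmorph_nat //.
by rewrite unitfE pnatr_eq0 -lt0n.
Qed.

Lemma r_conj : r^*%R = r.
Proof. by rewrite -conjcE /r conjc_real. Qed.

(** Inner products of rows thus become sums of powers of a single ratio of roots of unity. *)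
Lemma fourier_mul_conj (i i' j : 'I_N) :
  fourier R N i j * (fourier R N i' j)^*%R =
  N%:R^-1 * (w ^+ i * w ^- i') ^+ j.
Proof.
rewrite !fourierE rmorphM rmorphXn /= r_conj mulrACA r_sqr; congr (_ * _).
by rewrite dft_root_conjV [RHS]exprMn -!exprVn -!exprM.
Qed.

Lemma norm_fourier (i j : 'I_N) : `|fourier R N i j| = r.
Proof.
rewrite mxE cexp_imag normrM norm_cis mulr1 ger0_norm //.
by rewrite ler0c invr_ge0 sqrtr_ge0.
Qed.

End Fourier.

(** * Vanishing of geometric sums with periodic coefficients *)

Lemma sum_periodic_shift (V : zmodType) (h : nat -> V) (N s : nat) :
  (forall j, h (j + N)%N = h j) ->
  \sum_(j < N) h (j + s)%N = \sum_(j < N) h j.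
Proof.
move=> hN; elim: s => [|s IH]; first by under eq_bigr do rewrite addn0.
rewrite -IH; under eq_bigr do rewrite addnS -addSn.
(* N + 1 consecutive terms are split at the last and at the first one; by periodicity these two
   terms agree and cancel. *)
have e1 : \sum_(j < N.+1) h (j + s)%N = \sum_(j < N) h (j + s)%N + h (N + s)%N.
  by rewrite big_ord_recr.
have : \sum_(j < N.+1) h (j + s)%N = h s + \sum_(j < N) h (j.+1 + s)%N.
  by rewrite big_ord_recl.
by rewrite e1 addnC hN addrC => /addrI.
Qed.

(* Shifting the summation index by [q] multiplies the sum by [z ^+ q != 1]. *)
Lemma geometric_periodic_sum0 (K : fieldType) (g : nat -> K) (N q : nat) (z : K) :
  (q %| N)%N -> z ^+ N = 1 -> z ^+ q != 1 ->
  \sum_(j < N) g (j %% q)%N * z ^+ j = 0.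
Proof.
move=> qN zN zq; set S := \sum_(j < N) _.
have h : S = z ^+ q * S.
  rewrite -[LHS](@sum_periodic_shift _ (fun j => g (j %% q)%N * z ^+ j) _ q).
    rewrite mulr_sumr; apply: eq_bigr => j _.
    by rewrite modnDr exprD mulrA mulrC.
  move=> j; rewrite exprD zN mulr1; congr (g _ * _).
  by have /dvdnP[c ->] := qN; rewrite addnC modnMDl.
apply/eqP; move/eqP: h; rewrite -{1}[S]mul1r -subr_eq0 -mulrBl mulf_eq0.
by rewrite subr_eq0 eq_sym (negbTE zq).
Qed.

(* [M i j - M i' j] is periodic in [j], with a period [q] such that
   [z ^+ q != 1] for the ratio [z] of the two roots of unity. *)
Lemma order_constrained_sum0 (R : realType) (p k : nat) (M : 'M[R]_(p ^ k))
    (G : R -> R[i]) (i i' : 'I_(p ^ k)) :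
  (0 < p)%N -> order_constrained M -> i != i' ->
  \sum_j G (M i j - M i' j) *
    (dft_root R (p ^ k) ^+ i * dft_root R (p ^ k) ^- i') ^+ j = 0.
Proof.
move=> p0 HM ii'; set w := dft_root R (p ^ k).
have N0 : (0 < p ^ k)%N by rewrite expn_gt0 p0.
have wprim := dft_root_prim R N0; rewrite -/w in wprim.
(* The least such n is some m + 1. Congruence modulo p^m gives the period q = p^(k-m-1) of the row
   difference; incongruence modulo p^(m+1) gives z^q != 1, because p^(m+1) q = p^k. *)
have ex : exists n, i != i' %[mod p ^ n].
  by exists k; rewrite !modn_small.
case: (ex_minnP ex) => -[|m] hm hmin.
  by move: hm; rewrite expn0 !modn1.
have hm' : i = i' %[mod p ^ m].
  apply/eqP; rewrite -[_ == _]negbK; apply/negP => /hmin.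
  by rewrite ltnn.
have mk : (m < k)%N by apply: hmin; rewrite !modn_small.
set q := (p ^ (k - m.+1))%N.
have qN : (p ^ m.+1 * q = p ^ k)%N by rewrite expn_subnK.
have modq a b : (a * q == b * q %[mod p ^ k])%N = (a == b %[mod p ^ m.+1])%N.
  by rewrite -qN -!muln_modl eqn_pmul2r // expn_gt0 p0.
have zq : (w ^+ i * w ^- i') ^+ q != 1.
  rewrite exprMn exprVn -!exprM -subr_eq0.
  rewrite -(divff (expf_neq0 (i' * q) (dft_root_neq0 R (p ^ k)))) -/w.
  rewrite -mulrBl mulf_neq0 ?invr_eq0 ?expf_neq0 ?dft_root_neq0 // subr_eq0.
  by rewrite (eq_prim_root_expr wprim) modq.
have zN : (w ^+ i * w ^- i') ^+ (p ^ k) = 1.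
  rewrite exprMn exprVn -!exprM ![(_ * p ^ k)%N]mulnC !exprM.
  by rewrite (prim_expr_order wprim) !expr1n invr1 mulr1.
rewrite -[RHS](@geometric_periodic_sum0 _ (fun j => G (Delta i i' j M))
  _ _ _ _ zN zq).
  apply: eq_bigr => j _; rewrite -Delta_periodic //.
  by rewrite /Delta !entry_ord.
by rewrite -qN dvdn_mull.
Qed.

Lemma conj_trmxE (C : numClosedFieldType) (m n : nat) (A : 'M[C]_(m, n)) i j :
  (A^t*) i j = (A j i)^*%R.
Proof. by rewrite !mxE. Qed.

Definition imag_mx (R : realType) (N : nat) (M : 'M[R]_N) : 'M[R[i]]_N :=
  map_mx (fun x : R => 0 +i* x) M.

Definition phased_fourier (R : realType) (N : nat) (M : 'M[R]_N) : 'M[R[i]]_N :=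
  hadamard_product (fourier R N) (EXP (imag_mx M)).

Definition skew_fourier (R : realType) (N : nat) (M : 'M[R]_N) : 'M[R[i]]_N :=
  hadamard_product (imag_mx M) (fourier R N) *m (fourier R N)^t*.

Lemma phased_fourierE (R : realType) (N : nat) (M : 'M[R]_N) i j :
  phased_fourier M i j = fourier R N i j * cis (M i j).
Proof. by rewrite mxE [EXP _ _ _]mxE [imag_mx _ _ _]mxE cexp_imag. Qed.

Lemma phased_fourier0 (R : realType) (N : nat) :
  phased_fourier (0 : 'M[R]_N) = fourier R N.
Proof. by apply/matrixP => i j; rewrite phased_fourierE [X in cis X]mxE cis0 mulr1. Qed.

Lemma norm_phased_fourier (R : realType) (N : nat) (M : 'M[R]_N) i j :
  `|phased_fourier M i j| = ((Num.sqrt (N%:R : R))^-1)%:C.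
Proof. by rewrite phased_fourierE normrM norm_cis mulr1 norm_fourier. Qed.

(** * Unitarity of the phased matrices and the skew-Hermitian criterion *)

Section PrimePower.
Variables (R : realType) (p k : nat).
Hypothesis p_gt1 : (1 < p)%N.
Local Notation w := (dft_root R (p ^ k)).
Implicit Type M : 'M[R]_(p ^ k).

Let N_gt0 : (0 < p ^ k)%N. Proof. by rewrite expn_gt0 ltnW. Qed.
Let NC_neq0 : ((p ^ k)%:R : R[i]) != 0. Proof. by rewrite pnatr_eq0 -lt0n. Qed.

Lemma phased_fourier_unitary M :
  order_constrained M -> phased_fourier M \is unitarymx.
Proof.
move=> HM; apply/unitarymxP/matrixP => i i'; rewrite !mxE.
have e j : phased_fourier M i j * ((phased_fourier M)^t*) j i' =
    (p ^ k)%:R^-1 * (cis (M i j - M i' j) * (w ^+ i * w ^- i') ^+ j).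
  rewrite conj_trmxE !phased_fourierE rmorphM /= mulrACA.
  rewrite fourier_mul_conj // cisD cisN -!mulrA; congr (_ * _).
  by rewrite mulrCA; congr (_ * _); rewrite mulrC.
under eq_bigr => j _ do rewrite e.
rewrite -mulr_sumr; have [<-|ii'] := eqVneq i i'.
  rewrite (eq_bigr (fun=> 1)) => [|j _].
    by rewrite sumr_const card_ord mulVf.
  by rewrite subrr cis0 divff ?expf_neq0 ?dft_root_neq0 // expr1n mulr1.
(* Off the diagonal the sum vanishes by the case [G := cis]. *)
by rewrite order_constrained_sum0 ?mulr0 // ltnW.
Qed.

Lemma order_constrained0 : order_constrained (0 : 'M[R]_(p ^ k)).
Proof.
have e i j : entry i j (0 : 'M[R]_(p ^ k)) = 0.
  by rewrite /entry; do 2!case: insub => // ?; rewrite mxE.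
by move=> m _ i l t _ _ _; rewrite /Delta !e.
Qed.

Lemma fourier_unitary : fourier R (p ^ k) \is unitarymx.
Proof.
rewrite -phased_fourier0; exact/phased_fourier_unitary/order_constrained0.
Qed.

Lemma skew_fourierE M i i' : skew_fourier M i i' =
  'i * (p ^ k)%:R^-1 * \sum_j (M i j)%:C * (w ^+ i * w ^- i') ^+ j.
Proof.
rewrite mxE mulr_sumr; apply: eq_bigr => j _.
have -> : hadamard_product (imag_mx M) (fourier R (p ^ k)) i j =
    'i * (M i j)%:C * fourier R (p ^ k) i j.
  rewrite mxE; congr (_ * _); rewrite mxE.
  by apply/eqP; rewrite eq_complex /=; apply/andP; split; apply/eqP; ring.
rewrite conj_trmxE -!mulrA fourier_mul_conj //; congr (_ * _).
exact: mulrCA.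
Qed.

(** Transposition inverts the ratio of roots of unity and conjugation inverts it back, so only the
    row of [M] changes. *)
Lemma skew_fourier_conj M i i' : ((skew_fourier M)^t*) i i' =
  - ('i * (p ^ k)%:R^-1 * \sum_j (M i' j)%:C * (w ^+ i * w ^- i') ^+ j).
Proof.
rewrite conj_trmxE skew_fourierE !rmorphM rmorph_sum /= -!mulNr; congr (_ * _ * _).
- by apply/eqP; rewrite -conjcE eq_complex /= oppr0 !eqxx.
- by rewrite fmorphV rmorph_nat.
apply: eq_bigr => j _; rewrite rmorphM rmorphXn /=; congr (_ * _ ^+ _).
  exact: conjc_real.
rewrite rmorphM fmorphV !rmorphXn /= dft_root_conjV -!exprVn invrK.
by rewrite mulrC.
Qed.

Lemma skew_fourierP M : (skew_fourier M)^t* = - skew_fourier M <->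
  forall i i' : 'I_(p ^ k),
    \sum_j (M i j - M i' j)%:C * (w ^+ i * w ^- i') ^+ j = 0.
Proof.
have c0 : 'i * (p ^ k)%:R^-1 != 0 :> R[i].
  rewrite mulf_neq0 ?invr_eq0 //.
  by rewrite eq_complex /= eqxx /= oner_eq0.
have e i i' : \sum_j (M i j - M i' j)%:C * (w ^+ i * w ^- i') ^+ j =
    \sum_j (M i j)%:C * (w ^+ i * w ^- i') ^+ j -
    \sum_j (M i' j)%:C * (w ^+ i * w ^- i') ^+ j.
  by rewrite -sumrB; apply: eq_bigr => j _; rewrite rmorphB mulrBl.
split=> [/matrixP h i i'|h]; last first.
  apply/matrixP => i i'; rewrite skew_fourier_conj mxE skew_fourierE.
  congr (- (_ * _)); apply/eqP; rewrite eq_sym -subr_eq0 -e; exact/eqP.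
have := h i i'; rewrite skew_fourier_conj mxE skew_fourierE e.
by move=> /oppr_inj/(mulfI c0) ->; rewrite subrr.
Qed.

End PrimePower.

(** * Fourier inversion: from vanishing sums back to the constraints *)

Section Inversion.
Variables (R : realType) (p k : nat).
Hypothesis p_prime : prime p.
Let p_gt1 := prime_gt1 p_prime.
Local Notation w := (dft_root R (p ^ k)).
Variable M : 'M[R]_(p ^ k).
Hypothesis sum0 : forall i i' : 'I_(p ^ k),
  \sum_j (M i j - M i' j)%:C * (w ^+ i * w ^- i') ^+ j = 0.

Let N_gt0 : (0 < p ^ k)%N. Proof. by rewrite expn_gt0 ltnW. Qed.
Let NC_neq0 : ((p ^ k)%:R : R[i]) != 0. Proof. by rewrite pnatr_eq0 -lt0n. Qed.
Let wprim : (p ^ k).-primitive_root w. Proof. exact: dft_root_prim. Qed.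

(** The discrete Fourier coefficient of row i at the frequency x. Rows are read modulo p^k, so that
    shifts by arbitrary natural numbers make sense. *)
Let hat (i x : nat) : R[i] :=
  \sum_(j < p ^ k) (entry (i %% p ^ k) j M)%:C * (w ^- x) ^+ j.

Let hat_mod i i' x : i = i' %[mod p ^ k] -> hat i x = hat i' x.
Proof. by rewrite /hat => ->. Qed.

(** For the rows i and i + x the ratio in [sum0] is w^(-x), so the vanishing sum compares their
    coefficients at the frequency x itself. *)
Let hat_step i x : hat i x = hat (i + x) x.
Proof.
pose i0 := Ordinal (ltn_pmod i N_gt0).
pose i1 := Ordinal (ltn_pmod (i + x) N_gt0).
apply/eqP; rewrite -subr_eq0 /hat -sumrB; apply/eqP.
rewrite -[RHS](sum0 i0 i1); apply: eq_bigr => j _.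
rewrite -mulrBl -rmorphB -[entry (i %% _) j M]/(entry i0 j M).
rewrite -[entry ((i + x) %% _) j M]/(entry i1 j M) !entry_ord /=.
congr (_ * _ ^+ _).
rewrite !(prim_expr_mod wprim) exprD invfM mulrA divff ?mul1r //.
by rewrite expf_neq0 // dft_root_neq0.
Qed.

Let hat_mul c i x : hat i x = hat (i + c * x) x.
Proof.
elim: c => [|c ->]; first by rewrite mul0n addn0.
by rewrite hat_step; congr hat; rewrite mulSn; lia.
Qed.

(** As p is prime, gcd (x, p^k) is some p^l, and here l <= m. By Bezout, p^m is then a multiple of x
    modulo p^k, and steps of x do not change the coefficient. *)
Let hat_pow m i x : ~~ (p ^ m.+1 %| x)%N -> hat i x = hat (i + p ^ m) x.
Proof.
move=> hx; have x0 : (0 < x)%N by rewrite lt0n; apply: contraNneq hx => ->.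
case: (egcdnP (p ^ k) x0) => c c' hc _.
have [l lk hl] := dvdn_pfactor _ _ p_prime (dvdn_gcdr x (p ^ k)).
have lm : (l <= m)%N.
  rewrite leqNgt; apply: contra hx => ml.
  by apply: dvdn_trans (dvdn_gcdl x (p ^ k)); rewrite hl dvdn_exp2l.
have gE : (p ^ m = p ^ (m - l) * gcdn x (p ^ k))%N by rewrite hl -expnD subnK.
rewrite (hat_mul (p ^ (m - l) * c)); apply: hat_mod.
rewrite -mulnA hc mulnDr -gE mulnA addnA addnAC -[RHS]addn0.
by rewrite -modnDmr modnMl !addn0.
Qed.

Let col_sum (j j' : 'I_(p ^ k)) :
  \sum_(x < p ^ k) (w ^+ j * w ^- j') ^+ x = (p ^ k)%:R *+ (j == j').
Proof.
have /unitarymxP/matrixP/(_ j j') := fourier_unitary R k p_gt1.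
rewrite mxE [RHS]mxE => h.
rewrite -mulr_natr -h mulr_sumr; apply: eq_bigr => x _.
by rewrite conj_trmxE fourier_mul_conj // mulrA divff // mul1r.
Qed.

(** The difference of the rows i and i + p^m has Fourier coefficients only at multiples of p^(m+1);
    by inversion it has the period p^(k-m-1). *)
Lemma sum0_order_constrained : order_constrained M.
Proof.
move=> m mk i l t; rewrite mem_order_rows ?prime_gt0 // => hi hl ht.
set q := (p ^ (k - m.+1))%N.
have qN : (p ^ m.+1 * q = p ^ k)%N by rewrite expn_subnK.
have hlt : (l + t.+1 * q < p ^ k)%N.
  rewrite -qN; apply: leq_trans (_ : p * q <= _)%N.
    have : (t.+2 * q <= p * q)%N by rewrite leq_mul2r ht orbT.
    by rewrite !mulSn; lia.
  rewrite leq_mul2r expnS leq_pmulr ?orbT // expn_gt0 ltnW //.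
pose D (j : 'I_(p ^ k)) : R[i] := (Delta i (i + p ^ m) j M)%:C.
pose hD (x : nat) := \sum_j D j * (w ^- x) ^+ j.
have hD0 x : ~~ (p ^ m.+1 %| x)%N -> hD x = 0.
  move=> hx; have := hat_pow i hx; rewrite /hat => /eqP.
  rewrite -subr_eq0 -sumrB => /eqP h; rewrite -[RHS]h; apply: eq_bigr => j _.
  rewrite -mulrBl -rmorphB /= modn_small; last first.
    by apply: leq_ltn_trans hi; rewrite leq_addr.
  by rewrite modn_small.
have inv j : (p ^ k)%:R * D j = \sum_(x < p ^ k) hD x * (w ^+ j) ^+ x.
  under eq_bigr => x _ do rewrite /hD mulr_suml.
  rewrite exchange_big /=.
  transitivity (\sum_j' D j' * \sum_(x < p ^ k) (w ^+ j * w ^- j') ^+ x).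
    rewrite (bigD1 j) //= col_sum eqxx mulr1n big1 ?addr0 1?mulrC // => j' jj'.
    by rewrite col_sum eq_sym (negbTE jj') mulr0n mulr0.
  apply: eq_bigr => j' _; rewrite mulr_sumr; apply: eq_bigr => x _.
  rewrite -mulrA; congr (_ * _); rewrite mulrC exprMn; congr (_ * _).
  by rewrite !exprVn -!exprM mulnC.
have hlt' : (l + t * q < p ^ k)%N.
  by apply: leq_ltn_trans hlt; rewrite leq_add2l leq_mul2r leqnSn orbT.
suff : D (Ordinal hlt') = D (Ordinal hlt) by move/complexI.
apply: (mulfI NC_neq0); rewrite !inv; apply: eq_bigr => x _.
have [/dvdnP[y yE]|hx] := boolP (p ^ m.+1 %| x)%N; last by rewrite hD0 // !mul0r.
congr (_ * _); rewrite /= -!exprM.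
(* At x = y p^(m+1), a shift by q multiplies the character by w^(p^k y) = 1. *)
have -> : ((l + t.+1 * q) * x = (l + t * q) * x + p ^ k * y)%N.
  by rewrite yE -[in RHS]qN mulSn; ring.
by rewrite exprD [w ^+ (p ^ k * y)]exprM (prim_expr_order wprim) expr1n mulr1.
Qed.

End Inversion.

(** * The defect *)

Lemma set_dimE (K : fieldType) (V : vectType K) (S : set V) (W : {vspace V}) :
  S = [set x | x \in W] -> set_dim S = \dim W.
Proof.
move=> SE; rewrite /set_dim; case: xgetP => [d _ [W' [W'S ->]]|]; last first.
  by move=> /(_ (\dim W)) /=; case; exists W.
congr (\dim _); apply/vspaceP => x.
by apply/idP/idP => h; [have : S x by rewrite -W'S | have : [set x | x \in W'] x
  by rewrite W'S SE]; rewrite ?SE.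
Qed.

Lemma scale_add_mxE (K : pzRingType) (m n : nat) (a : K) (A B : 'M[K]_(m, n))
  i j : (a *: A + B) i j = a * A i j + B i j.
Proof. by rewrite !mxE. Qed.

Section SkewHermitian.
Variables (R : realType) (N : nat).
Implicit Types (A B : 'M[R]_N) (E : 'M[R[i]]_N).

(* Skew-Hermitian matrices are parametrized by arbitrary real matrices: the
   antisymmetric part is the real part, the symmetric part the imaginary one. *)
Definition skew_of_real A : 'M[R[i]]_N :=
  \matrix_(i, j) (((A i j - A j i) / 2) +i* ((A i j + A j i) / 2)).

Definition real_of_skew E : 'M[R]_N :=
  \matrix_(i, j) (complex.Re (E i j) + complex.Im (E i j)).

Lemma skew_of_realK A : real_of_skew (skew_of_real A) = A.
Proof. by apply/matrixP => i j; rewrite !mxE /=; field. Qed.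

Lemma skew_of_real_skew A : (skew_of_real A)^t* = - skew_of_real A.
Proof.
apply/matrixP => i j; rewrite conj_trmxE !mxE -conjcE.
by apply/eqP; rewrite eq_complex /=; apply/andP; split; apply/eqP; field.
Qed.

Lemma real_of_skewK E : E^t* = - E -> skew_of_real (real_of_skew E) = E.
Proof.
move=> /matrixP h; apply/matrixP => i j; have := h j i.
rewrite conj_trmxE !mxE -conjcE; case: (E i j) (E j i) => [a b] [c d] /= [e1 e2].
by apply/eqP; rewrite eq_complex /=; apply/andP; split; apply/eqP;
  rewrite ?e1; lra.
Qed.

Lemma skew_of_real_linear a A B :
  skew_of_real (a *: A + B) = a%:C *: skew_of_real A + skew_of_real B.
Proof.
apply/matrixP => i j; rewrite !mxE; apply/eqP; rewrite eq_complex /=.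
by apply/andP; split; apply/eqP; field.
Qed.

End SkewHermitian.

Section Defect.
Variables (R : realType) (p k : nat).
Hypothesis p_prime : prime p.
Let p_gt1 := prime_gt1 p_prime.
Local Notation F := (fourier R (p ^ k)).
Implicit Types A B M : 'M[R]_(p ^ k).

Let N_gt0 : (0 < p ^ k)%N. Proof. by rewrite expn_gt0 ltnW. Qed.
Let NR_neq0 : ((p ^ k)%:R : R) != 0. Proof. by rewrite pnatr_eq0 -lt0n. Qed.
Let NC_neq0 : ((p ^ k)%:R : R[i]) != 0. Proof. by rewrite pnatr_eq0 -lt0n. Qed.

Let T A i j : R[i] := conjc (F i j) * (skew_of_real A *m F) i j.

Let T_linear a A B i j : T (a *: A + B) i j = a%:C * T A i j + T B i j.
Proof.
rewrite /T skew_of_real_linear mulmxDl -scalemxAl scale_add_mxE.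
by rewrite mulrDr mulrCA.
Qed.

Definition tangent_re A : 'M[R]_(p ^ k) := Df F (skew_of_real A *m F).
(** The factor p^k undoes |F_(i, j)|^2 = 1 / p^k, so that on the kernel of [tangent_re] this returns
    the real matrix M with E F = i (M o F). *)
Definition tangent_im A : 'M[R]_(p ^ k) :=
  \matrix_(i, j) ((p ^ k)%:R * complex.Im (T A i j)).

Let tangent_reE A i j : tangent_re A i j = 2 * complex.Re (T A i j).
Proof. by rewrite mxE. Qed.

Let tangent_imE A i j : tangent_im A i j = (p ^ k)%:R * complex.Im (T A i j).
Proof. by rewrite mxE. Qed.

Let ReD (a : R) (x y : R[i]) :
  complex.Re (a%:C * x + y) = a * complex.Re x + complex.Re y.
Proof. by case: x y => [b c] [d e] /=; rewrite mul0r subr0. Qed.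

Let ImD (a : R) (x y : R[i]) :
  complex.Im (a%:C * x + y) = a * complex.Im x + complex.Im y.
Proof. by case: x y => [b c] [d e] /=; rewrite mul0r addr0. Qed.

Lemma tangent_re_linear : linear tangent_re.
Proof.
move=> a A B; apply/matrixP => i j.
rewrite scale_add_mxE !tangent_reE T_linear ReD.
by rewrite mulrDr mulrCA.
Qed.

Lemma tangent_im_linear : linear tangent_im.
Proof.
move=> a A B; apply/matrixP => i j.
rewrite scale_add_mxE !tangent_imE T_linear ImD.
by rewrite mulrDr mulrCA.
Qed.

Let conjF_F i j : conjc (F i j) * F i j = (p ^ k)%:R^-1.
Proof.
rewrite conjcE mulrC fourier_mul_conj // divff ?expf_neq0 ?dft_root_neq0 //.
by rewrite expr1n mulr1.
Qed.

Let F_neq0 i j : F i j != 0.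
Proof.
apply/eqP => h; have := conjF_F i j; rewrite h mulr0 => /eqP.
by rewrite eq_sym invr_eq0 (negbTE NC_neq0).
Qed.

Let FFt : F *m F^t* = 1%:M. Proof. exact/unitarymxP/fourier_unitary. Qed.
Let FtF : F^t* *m F = 1%:M. Proof. exact: mulmx1C FFt. Qed.

(* [A] is in the kernel of [tangent_re] exactly when [E F = i (M o F)] for
   the skew-Hermitian matrix [E] of [A] and a real matrix [M]. *)
Let T_skew_fourier A M :
  (forall i j, T A i j = 'i * ((M i j)%:C * (p ^ k)%:R^-1)) <->
  skew_of_real A = skew_fourier M.
Proof.
have hE i j : conjc (F i j) * hadamard_product (imag_mx M) F i j =
    'i * ((M i j)%:C * (p ^ k)%:R^-1).
  rewrite [hadamard_product _ _ _ _]mxE -(conjF_F i j) mulrCA [RHS]mulrA.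
  rewrite [imag_mx _ _ _]mxE; congr (_ * _).
  by apply/eqP; rewrite eq_complex /=; apply/andP; split; apply/eqP; ring.
split=> h.
  rewrite /skew_fourier -[LHS]mulmx1 -FFt mulmxA; congr (_ *m _).
  apply/matrixP => i j; apply: (mulfI (_ : conjc (F i j) != 0)).
    by rewrite conjc_eq0.
  by rewrite hE -h.
by move=> i j; rewrite /T h /skew_fourier -mulmxA FtF mulmx1 hE.
Qed.

Let T_eq A M : tangent_re A = 0 -> tangent_im A = M ->
  skew_of_real A = skew_fourier M.
Proof.
move=> /matrixP hr /matrixP hi; apply/T_skew_fourier => i j.
have := hr i j; rewrite tangent_reE [RHS]mxE => /eqP.
rewrite mulf_eq0 pnatr_eq0 /= => /eqP h1.
have := hi i j; rewrite tangent_imE => <-; rewrite rmorphM /= mulrAC rmorph_nat divff //.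
rewrite mul1r; case: (T A i j) h1 => a b /= ->.
by apply/eqP; rewrite eq_complex /=; apply/andP; split; apply/eqP; ring.
Qed.

(** The matrices M so obtained are those for which [skew_fourier M] is skew-Hermitian. Fourier
    inversion gives one inclusion, the vanishing of the periodic sums the other. *)
Lemma tangent_kernel_image :
  (linfun tangent_im @: lker (linfun tangent_re))%VS = order_space R p k.
Proof.
apply/vspaceP => M; apply/memv_imgP/idP => [[A]|].
  rewrite memv_ker linfunE; last exact: tangent_re_linear.
  move=> /eqP hA; rewrite linfunE; last exact: tangent_im_linear.
  move=> ->; apply/mem_order_space/sum0_order_constrained => //.
  apply/skew_fourierP => //.
  by rewrite -(T_eq hA erefl) skew_of_real_skew.
move=> /(mem_order_space p_gt1) HM.
have sk : (skew_fourier M)^t* = - skew_fourier M.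
  apply/skew_fourierP => // i i'; have [<-|ii'] := eqVneq i i'.
    by rewrite big1 // => j _; rewrite subrr mul0r.
  apply: (order_constrained_sum0 (fun x => x%:C)) => //.
  exact: prime_gt0.
have /T_skew_fourier h := real_of_skewK sk.
have hT i j : T (real_of_skew (skew_fourier M)) i j = 0 +i* (M i j / (p ^ k)%:R).
  rewrite h -(rmorph_nat (real_complex R)) -fmorphV -rmorphM /=.
  by apply/eqP; rewrite eq_complex /=; apply/andP; split; apply/eqP; ring.
exists (real_of_skew (skew_fourier M)).
  rewrite memv_ker linfunE; last exact: tangent_re_linear.
  by apply/eqP/matrixP => i j; rewrite tangent_reE hT /= mulr0 [RHS]mxE.
rewrite linfunE; last exact: tangent_im_linear.
by apply/matrixP => i j; rewrite tangent_imE hT /= mulrCA divff // mulr1.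
Qed.

Lemma tangent_image :
  Df F @` tangent_unitary F = [set M | M \in limg (linfun tangent_re)].
Proof.
apply/seteqP; split=> [_ [_ [E hE <-] <-]|M /= /memv_imgP[A _ ->]].
  apply/memv_imgP; exists (real_of_skew E); first exact: memvf.
  rewrite linfunE; last exact: tangent_re_linear.
  by rewrite /tangent_re real_of_skewK.
rewrite linfunE; last exact: tangent_re_linear.
exists (skew_of_real A *m F) => //; exists (skew_of_real A) => //.
exact: skew_of_real_skew.
Qed.

Lemma fourier_defect :
  defect F = ((p ^ k - 1) ^ 2 - (p ^ k * p ^ k - \dim (order_space R p k)))%N.
Proof.
have -> : \dim (order_space R p k) = \dim (lker (linfun tangent_re)).
  rewrite -tangent_kernel_image limg_dim_eq //.
  (* [tangent_im] is injective on the kernel of [tangent_re]: M = 0 makes the skew-Hermitian matrix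
     zero, hence also A. *)
  apply/eqP; rewrite -subv0; apply/subvP => A.
  rewrite memv_cap !memv_ker !linfunE; first last.
  - exact: tangent_re_linear.
  - exact: tangent_im_linear.
  move=> /andP[/eqP h1 /eqP h2]; rewrite memv0.
  have := T_eq h1 h2.
  rewrite /skew_fourier (_ : hadamard_product _ _ = 0) ?mul0mx; last first.
    by apply/matrixP => i j; rewrite !mxE mul0r.
  move=> h; rewrite -(skew_of_realK A) h.
  by apply/eqP/matrixP => i j; rewrite !mxE /= addr0.
rewrite /defect (set_dimE tangent_image); congr (_ - _)%N.
have := limg_ker_dim (linfun tangent_re) fullv.
by rewrite capfv [\dim fullv]dimvf /dim /= => <-; rewrite addKn.
Qed.

End Defect.

(** * The affine family *)

Section AffineFamily.
Variables (R : realType) (p k d : nat).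
Hypotheses (p_gt1 : (1 < p)%N) (k_gt1 : (1 < k)%N).
Hypothesis dE : d = (p ^ (k - 1) * ((k - 1) * p - k) + 1)%N.
Variable B : d.-tuple 'M[R]_(p ^ k).
Hypothesis B_basis : basis_of (RF_space R p k) B.

Let N_gt0 : (0 < p ^ k)%N. Proof. by rewrite expn_gt0 ltnW. Qed.

Definition phase_comb (x : 'rV[R]_d) : 'M[R]_(p ^ k) :=
  \sum_(i < d) x 0 i *: tnth B i.

Definition phase_mx : 'M[R]_(d, p ^ k * p ^ k) :=
  \matrix_(i < d) mxvec (tnth B i).

Definition fourier_phase : 'rV[R]_(p ^ k * p ^ k) :=
  mxvec (\matrix_(i < p ^ k, j < p ^ k) (2 * pi / (p ^ k)%:R * i%:R * j%:R)).

Lemma phase_combE x i j : (x *m phase_mx) 0 (mxvec_index i j) = phase_comb x i j.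
Proof.
rewrite -[RHS]mxvecE mulmx_sum_row /phase_comb linear_sum /=.
congr (fun_of_matrix _ _ _).
by apply: eq_bigr => l _; rewrite rowK linearZ.
Qed.

Lemma phase_comb_RF x : RF R p k (phase_comb x).
Proof.
apply/(mem_RF_space p_gt1); apply: memv_suml => i _; apply: memvZ.
by apply: (basis_mem B_basis); exact: mem_tnth.
Qed.

Lemma phase_comb_eq0 x : phase_comb x = 0 -> x = 0.
Proof.
move=> h; apply/rowP => i; rewrite mxE.
have /freeP := basis_free B_basis; apply; rewrite -[RHS]h.
by apply: eq_bigr => j _; rewrite (tnth_nth 0).
Qed.

Lemma affine_family_torus : affine_family (fourier R (p ^ k)) B =
  torus_map ((Num.sqrt ((p ^ k)%:R : R))^-1) phase_mx fourier_phase.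
Proof.
apply: funext => x; rewrite /affine_family -/(phase_comb x).
rewrite -/(imag_mx (phase_comb x)) -/(phased_fourier (phase_comb x)).
have e i j : phased_fourier (phase_comb x) i j =
    ((Num.sqrt ((p ^ k)%:R : R))^-1)%:C *
      cis (phase_comb x i j + 2 * pi / (p ^ k)%:R * i%:R * j%:R).
  by rewrite phased_fourierE mxE cexp_imag addrC cisD mulrA.
apply/rowP => l; case: (split_ordP l) => {}l ->; case/mxvec_indexP: l => i j.
  rewrite row_mxEl mxvecE mxE e torus_mapl phase_combE mxvecE mxE /=.
  by rewrite mul0r subr0.
rewrite row_mxEr mxvecE mxE e torus_mapr phase_combE mxvecE mxE /=.
by rewrite mul0r addr0.
Qed.

(** The default index 0 is never reached on pivots, which are all in bounds. *)
Let ord_of (n : nat) : 'I_(p ^ k) := insubd (Ordinal N_gt0) n.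

Definition pivot_index (l : 'I_(size (pivots p k))) : 'I_(p ^ k * p ^ k) :=
  let x := nth (0, 0)%N (pivots p k) l in mxvec_index (ord_of x.1) (ord_of x.2).

Lemma pivot_determined (G : R -> Prop) (x : 'rV[R]_d) :
  G 0 -> (forall x y z, G x -> G y -> G z -> G (x + y - z)) ->
  (forall l, G ((x *m phase_mx) 0 (pivot_index l))) ->
  forall l, G ((x *m phase_mx) 0 l).
Proof.
move=> G0 hG hl l; case/mxvec_indexP: l => i j; rewrite phase_combE.
apply: RF_determined => //; first exact: phase_comb_RF.
move=> y yp; have iy : (index y (pivots p k) < size (pivots p k))%N.
  by rewrite index_mem.
have := hl (Ordinal iy); rewrite /pivot_index /= nth_index // phase_combE.
rewrite -entry_ord /ord_of !val_insubd.
by case: y yp {iy} => a b /(pivots_bound p_gt1)[/= -> ->].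
Qed.

Lemma pivot_row_free : row_free (colsub pivot_index phase_mx).
Proof.
apply: inj_row_free => v hv; apply: phase_comb_eq0.
apply/matrixP => i j; rewrite -phase_combE [RHS]mxE.
apply: (@pivot_determined (fun x => x = 0)) => //.
  by move=> a b c -> -> ->; rewrite addr0 subr0.
by move=> l; move/rowP/(_ l): hv; rewrite mulmx_colsub mxE => ->; rewrite mxE.
Qed.

(** There are exactly d pivots, so the submatrix is square and its free rows make it invertible. *)
Lemma pivot_row_full : row_full (colsub pivot_index phase_mx).
Proof.
have sd : size (pivots p k) = d by rewrite dE (size_pivotsE p_gt1 k_gt1).
by move: pivot_row_free; rewrite /row_free /row_full => /eqP ->; rewrite sd.
Qed.

Lemma affine_family_local_parametrization x :
  exists U : set 'rV[R]_d, U x /\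
    local_parametrization (range (affine_family (fourier R (p ^ k)) B)) U
      (affine_family (fourier R (p ^ k)) B).
Proof.
rewrite affine_family_torus; eexists; apply: torus_local_parametrization.
- by rewrite invr_gt0 sqrtr_gt0 ltr0n.
- exact: pivot_row_free.
- exact: pivot_row_full.
(* The periodicity hypothesis of the torus: 2 pi Z is closed under x + y - z, so phases lying in it
   at the pivots lie in it everywhere. *)
move=> y hy; apply: (@pivot_determined
  (fun x => exists z : int, x = z%:~R * (pi *+ 2))) => //.
  by exists 0; rewrite mul0r.
move=> _ _ _ [a ->] [b ->] [c ->]; exists (a + b - c).
by rewrite rmorphB rmorphD /= mulrBl mulrDl.
Qed.

End AffineFamily.

Local Close Scope sesquilinear_scope.
Local Close Scope complex_scope.

Theorem theorem6p2 (R : realType) (p k : nat) (hp : prime p) (hk : (1 < k)%N) :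
  free (constraint_forms R p k) /\
  defect (fourier R (p ^ k)) = (p ^ (k - 1) * ((k - 1) * p - k) + 1)%N /\
  exists V : {vspace 'M[R]_(p ^ k)},
    [/\ [set M | M \in V] = RF R p k,
        \dim V = defect (fourier R (p ^ k)) &
        forall B : (defect (fourier R (p ^ k))).-tuple 'M[R]_(p ^ k),
          basis_of V B ->
          let F := affine_family (fourier R (p ^ k)) B in
          [/\ submanifold (defect (fourier R (p ^ k))) (range F),
              range F (vecR (fourier R (p ^ k))),
              parametrized_by (range F) F &
              forall y, range F y -> exists V' : 'M[R[i]]_(p ^ k),
                [/\ y = vecR V', unitary_complex_hadamard V' &
                    dephased_wrt (fourier R (p ^ k)) V']]].
Proof.
have p1 := prime_gt1 hp; have k0 := ltnW hk.
have dE : defect (fourier R (p ^ k)) = (p ^ (k - 1) * ((k - 1) * p - k) + 1)%N.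
  by rewrite fourier_defect // dim_order_space_defect.
split; first exact: constraint_forms_free.
split=> //; exists (RF_space R p k); split.
- by apply/seteqP; split=> M /(mem_RF_space p1).
- by rewrite dE dim_RF_space.
(* The defect occurs in the type of [B]; it is generalized to a number [d] known only through its
   value. *)
move: (defect _) dE => d dE B hB F.
split.
- move=> _ [x _ <-]; have [U [Ux hU]] := affine_family_local_parametrization p1 hk dE hB x.
  by exists U, F; split=> //; exists x.
- exists 0 => //; rewrite /F /affine_family big1 => [|i _]; last first.
    by rewrite mxE scale0r.
  by rewrite -[hadamard_product _ _]/(phased_fourier _) phased_fourier0.
- by split=> // x; exact: affine_family_local_parametrization.
move=> _ [x _ <-]; exists (phased_fourier (phase_comb B x)); split=> //.
  split=> [|i j]; last exact: norm_phased_fourier.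
  by apply: phased_fourier_unitary => //; case: (phase_comb_RF p1 hB x).
have [_ [h1 h2]] := phase_comb_RF p1 hB x.
move=> i j ij; rewrite phased_fourierE -entry_ord.
suff -> : entry i j (phase_comb B x) = 0 by rewrite cis0 mulr1.
(* Position (0, 0) falls under the column constraints [h1], since [h2] starts at column 1. *)
have [j0|j0] := posnP j; first by rewrite j0 h1.
by case: ij => [/= ->|/= j0']; [rewrite h2 // j0 /= | move: j0; rewrite j0'].
Qed.
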